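(* Let $\sigma>0$, let $f:\mathbb{R}^n\to\mathbb{R}$ be locally Lipschitz continuous, and let $g(x):=f(x)+\frac{\sigma}{2}\|x\|^2$. Assume: (A1) $f$ is path-differentiable and admits a convex-valued set-valued mapping $\mathcal{D}_f$ as its conservative field; (A2) the set $\{g(x):x\in\mathbb{R}^n,\ 0\in\mathcal{D}_f(x)+\sigma x\}$ has empty interior in $\mathbb{R}$; (A3) $\inf_{x\in\mathbb{R}^n}g(x)>-\infty$. Let $\{x_k\},\{m_k\},\{v_k\},\{g_k\},\{d_k\},\{\xi_k\}$ be sequences generated by the framework (AFMDW) described in the context, and assume: (B1) there exist constants $0<\varepsilon_v<M_v$ such that $\varepsilon_v\le H(v_k)\le M_v$ (entrywise) for all $k\ge 0$; (B2) there exists a constant $M_x$ such that almost surely $\max\{\|m_0\|,\sup_{k\ge0}\|x_k\|\}\le M_x$; (B3) the stepsizes $\{\eta_k\}$, $\{\theta_k\}$ are positive and satisfy $\inf_{k\ge0}\eta_k>0$, $\sup_{k\ge0}\eta_k<\frac{2}{\sigma M_v}$, $\sum_{k=0}^\infty\theta_k=\infty$, $\lim_{k\to\infty}\theta_k\log(k)=0$; (B4) there exists a nonnegative sequence $\{\delta_k\}$ with $\lim_{k\to\infty}\delta_k=0$ and $d_k\in\mathcal{D}_f^{\delta_k}(x_k)$ for all $k$; (B5) $\{\xi_k\}$ is a uniformly bounded martingale difference sequence: there is a constant $M_\xi$ such that almost surely $\sup_{k\ge0}\|\xi_k\|\le M_\xi$, and $\mathbb{E}[\xi_{k+1}\mid\mathcal{F}_k]=0$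 for all $k\ge0$. Then almost surely, any cluster point of $\{x_k\}$ is a $\mathcal{D}_g$-stationary point of $g$, and the sequence $\{g(x_k)\}$ converges.
   Context: All random variables live on a probability space $(\Omega,\mathcal{F},\mathbb{P})$ with a filtration $\{\mathcal{F}_k\}$ to which $\{\xi_k\}$ is adapted. $\odot$ is the entrywise product. Framework (AFMDW): from an initial point $(x_0,m_0,v_0)$, for $k\ge0$: $g_k=d_k+\xi_{k+1}$; $m_{k+1}=(1-\theta_k)m_k+\theta_k g_k$; choose an estimator $v_{k+1}\in\mathbb{R}^n$ (by any rule); $x_{k+1}=x_k-\eta_k H(v_{k+1})\odot(m_{k+1}+\sigma x_k)$. Here $H:\mathbb{R}^n\to\mathbb{R}^n$ is a given mapping. A conservative field on $\mathbb{R}^n$ is a graph-closed set-valued mapping $\mathcal{D}:\mathbb{R}^n\rightrightarrows\mathbb{R}^n$ with nonempty compact values such that $\int_0^1\max_{v\in\mathcal{D}(\gamma(t))}\langle\gamma'(t),v\rangle\,dt=0$ for every absolutely continuous $\gamma:[0,1]\to\mathbb{R}^n$ with $\gamma(0)=\gamma(1)$. A function $f$ is a potential for $\mathcal{D}$ (equivalently, $\mathcal{D}$ is a conservative field for $f$, or $f$ admits $\mathcal{D}$ as its conservative field) if $f(\gamma(1))=f(\gamma(0))+\int_0^1\max_{d\in\mathcal{D}(\gamma(t))}\langle\gamma'(t),d\rangle\,dt$ for every absolutely continuous $\gamma:[0,1]\to\mathbb{R}^n$. A locally Lipschitz function is path-differentiable if it is the potential of some conservative field. For a set-valued mapping $\mathcal{D}$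 and $\delta\ge0$, $\mathcal{D}^\delta(x):=\{w\in\mathbb{R}^n:\exists z\in\mathbb{B}_\delta(x),\ \mathrm{dist}(w,\mathcal{D}(z))\le\delta\}$, where $\mathbb{B}_\delta(x)$ is the ball of radius $\delta$ centred at $x$. $\mathcal{D}_g(x):=\mathcal{D}_f(x)+\sigma x$, a convex-valued conservative field for $g$. A point $x$ is $\mathcal{D}_g$-stationary for $g$ if $0\in\mathrm{conv}(\mathcal{D}_g(x))$ (i.e. $0\in\mathcal{D}_g(x)$ here). *)

(* Defs.v *)
(* R^n is ['rV[R]_n].  The library norm [`|x|] on it is the sup norm, used here
   only through the topology and in [locally_lipschitz], where the choice of
   norm is irrelevant; ||.|| in the mathematics is the Euclidean [enorm]. *)
From HB Require Import structures.
From mathcomp Require Import all_boot all_order all_algebra.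
From mathcomp Require Import all_classical all_reals all_analysis.
Set Implicit Arguments.
Unset Strict Implicit.
Unset Printing Implicit Defensive.
Import Order.TTheory GRing.Theory Num.Theory numFieldNormedType.Exports.
Local Open Scope classical_set_scope.
Local Open Scope ring_scope.

Section Euclidean.
Context {R : realType} {n : nat}.
Implicit Types (u v w x y : 'rV[R]_n) (A : set 'rV[R]_n).

Definition dotv u v : R := \sum_(i < n) u 0 i * v 0 i.

Definition enorm u : R := Num.sqrt (dotv u u).

Definition hadamard u v : 'rV[R]_n := \row_i (u 0 i * v 0 i).

(* Junk value [inf set0 = 0] when [A] is empty; only used for nonempty [A]. *)
Definition dist w A : R := inf [set enorm (w - a) | a in A].

Definition conv_hull A : set 'rV[R]_n :=
  smallest (@convex_set R 'rV[R]_n) A.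

Definition locally_lipschitz (f : 'rV[R]_n -> R) : Prop :=
  forall x, exists2 U : set 'rV[R]_n, nbhs x U & [lipschitz f y | y in U].

End Euclidean.

Section ConservativeFields.
Context {R : realType} {n : nat}.
Implicit Types (D : 'rV[R]_n -> set 'rV[R]_n) (f : 'rV[R]_n -> R).

(* Curves [0, 1] -> R^n are represented by functions on R, of which only the
   restriction to [0, 1] matters: the two-sided derivative [derive1] below
   depends on values outside [0, 1] only at the endpoints, a null set. *)
Definition abs_continuous01 (gamma : R -> 'rV[R]_n) : Prop :=
  forall e : R, 0 < e -> exists2 delta : R, 0 < delta &
    forall (N : nat) (a b : 'I_N -> R),
      (forall i, [/\ 0 <= a i, a i <= b i & b i <= 1]) ->
      (forall i j, i != j -> b i <= a j \/ b j <= a i) ->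
      \sum_(i < N) (b i - a i) < delta ->
      \sum_(i < N) enorm (gamma (b i) - gamma (a i)) < e.

(* [sup] is the maximum, [D x] being nonempty and compact where this is used. *)
Definition max_dot D x (u : 'rV[R]_n) : R := sup [set dotv u v | v in D x].

(* The extended-real integral of a measurable function is finite only if the
   function is integrable ([+oo - +oo = -oo] in [\bar R]), so the equations
   below contain the integrability of the integrand. *)
Definition path_integral D (gamma : R -> 'rV[R]_n) : \bar R :=
  (\int[lebesgue_measure]_(t in `[0%R, 1%R])
     (max_dot D (gamma t) (derive1 gamma t))%:E)%E.

Definition conservative_field D : Prop :=
  [/\ closed [set p : 'rV[R]_n * 'rV[R]_n | D p.1 p.2],
      forall x, D x !=set0,
      forall x, compact (D x) &
      forall gamma, abs_continuous01 gamma -> gamma 0 = gamma 1 ->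
        path_integral D gamma = 0%E].

Definition potential f D : Prop :=
  forall gamma, abs_continuous01 gamma ->
    ((f (gamma 1))%:E = (f (gamma 0))%:E + path_integral D gamma)%E.

Definition path_differentiable f : Prop :=
  locally_lipschitz f /\ exists2 D, conservative_field D & potential f D.

(* [z] ranges over the closed ball, so that [enlargement D 0 = D] when the
   values of [D] are nonempty and closed. *)
Definition enlargement D (delta : R) (x : 'rV[R]_n) : set 'rV[R]_n :=
  [set w | exists2 z, enorm (z - x) <= delta & dist w (D z) <= delta].

Definition stationary D (x : 'rV[R]_n) : Prop := conv_hull (D x) 0.

(* The objective g = f + (sigma / 2) ||.||^2 and D_g = D_f + sigma id. *)
Definition regularized (sigma : R) f (x : 'rV[R]_n) : R :=
  f x + sigma / 2 * enorm x ^+ 2.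

Definition regularized_field (sigma : R) D (x : 'rV[R]_n) : set 'rV[R]_n :=
  [set v + sigma *: x | v in D x].

End ConservativeFields.

Section Probability.
Context {R : realType} {n : nat} {disp : measure_display}.
Context {Omega : measurableType disp}.

(* Measurability of [X] from the sigma-algebra [G] to the Borel sets of R^n. *)
Definition measurable_wrt (G : set_system Omega) (X : Omega -> 'rV[R]_n) :
    Prop :=
  forall B : set 'rV[R]_n, <<s [set U : set 'rV[R]_n | open U] >> B ->
    G (X @^-1` B).

Definition random_vector (X : Omega -> 'rV[R]_n) : Prop :=
  measurable_wrt measurable X.

Definition filtration (F : nat -> set_system Omega) : Prop :=
  [/\ forall k, sigma_algebra setT (F k),
      forall k, F k `<=` measurable &
      forall k, F k `<=` F k.+1].

Definition adapted (F : nat -> set_system Omega)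
    (X : nat -> Omega -> 'rV[R]_n) : Prop :=
  forall k, measurable_wrt (F k) (X k).

Variable P : probability Omega R.

(* [Y] is a version of E[X | G]; conditional expectations of random vectors
   are taken coordinatewise. *)
Definition is_cond_expectation (G : set_system Omega)
    (X Y : Omega -> 'rV[R]_n) : Prop :=
  measurable_wrt G Y /\ forall i : 'I_n,
    [/\ P.-integrable setT (fun w => (X w 0 i)%:E),
        P.-integrable setT (fun w => (Y w 0 i)%:E) &
        forall A, G A ->
          (\int[P]_(w in A) (Y w 0 i)%:E = \int[P]_(w in A) (X w 0 i)%:E)%E].

Definition bounded_martingale_difference (F : nat -> set_system Omega)
    (xi : nat -> Omega -> 'rV[R]_n) : Prop :=
  [/\ adapted F xi,
      exists Mxi : R, {ae P, forall w, forall k, enorm (xi k w) <= Mxi} &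
      forall k, is_cond_expectation (F k) (xi k.+1) (cst 0)].

End Probability.

(* [gr] is the sequence g_k; nothing constrains [v], which may follow any
   rule. *)
Definition AFMDW {R : realType} {n : nat} (H : 'rV[R]_n -> 'rV[R]_n)
    (sigma : R) (eta theta : nat -> R)
    (x m v gr d xi : nat -> 'rV[R]_n) : Prop :=
  forall k : nat,
    [/\ gr k = d k + xi k.+1,
        m k.+1 = (1 - theta k) *: m k + theta k *: gr k &
        x k.+1 = x k - eta k *: hadamard (H (v k.+1))
                                         (m k.+1 + sigma *: x k)].

(* Main.v *)
Require Import Defs.
From HB Require Import structures.
From mathcomp Require Import all_boot all_order all_algebra.
From mathcomp Require Import all_classical all_reals all_analysis.
From mathcomp Require Import measurable_realfun.
From mathcomp Require Import ring lra.
Import Order.TTheory GRing.Theory Num.Theory numFieldNormedType.Exports.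
Local Open Scope classical_set_scope.
Local Open Scope ring_scope.
Set Implicit Arguments.
Unset Strict Implicit.
Unset Printing Implicit Defensive.

(** Weight decay decoupled from the preconditioner makes the iterates follow the
    momentum. For frozen [m] the map [x |-> x - eta H (m + sigma x)], with [H]
    acting entrywise, contracts in every coordinate towards [- m / sigma],
    because [0 < eta sigma H < 2] uniformly. The steps [theta k] tend to [0], so
    the momentum moves slowly and [x k] approaches [y k = - m k / sigma]
    ([iterates_track_momentum]). The sequence [y] satisfies
    [y k.+1 = y k - (theta k / sigma) (d k + sigma y k + xi k.+1)]: it is a
    stochastic subgradient sequence for [g], in which the preconditioner and the
    step sizes [eta] no longer occur, and whose direction [d k + sigma y k] is
    asymptotically close to [Dg (y k)].

    The noise. In the time scale given by the sums of the steps, the noise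
    collected over a window of fixed length tends to [0] almost surely
    ([martingale_windows_cvg0]). This is where [theta k * ln k] tending to [0] is
    used: Chernoff's bound for bounded martingale differences is then summable
    over the starting points of the windows.

    The limit. Late windows of [y], followed along an ultrafilter, converge
    pointwise to a Lipschitz curve ([limit_curve]) that solves
    [gamma' = - v] with [v] in [Dg gamma], by convexity and upper semicontinuity
    of the field ([limit_curve_inclusion]). Upper semicontinuity rests on local
    boundedness, which a conservative field with convex values inherits from its
    Lipschitz potential ([conservative_locally_bounded]). A Lipschitz curve is
    differentiable almost everywhere and is the primitive of its derivative
    ([lipschitz_primitive]), so the chain rule applies to the reversed curve and
    shows that [g] decreases along [gamma] at rate [|gamma'|^2]
    ([lipschitz_descent]). Hence near a nonstationary point, [g] decreases along
    [y] by a fixed amount over every short window ([window_descent]).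

    The conclusion is an argument on upcrossings. If [g] took two values at
    cluster points of [y], then, since the stationary values have empty interior,
    [g (y k)] would cross some noncritical value upwards infinitely often; at a
    cluster point of the crossing times this contradicts the decrease
    ([cluster_values_le]). So [g] has one value at the cluster points, a
    nonstationary cluster point would create a smaller one
    ([cluster_stationary]), and both properties pass from [y] to [x]. *)

(** * Lipschitz functions of one real variable are primitives *)

Section LipschitzPrimitive.
Context {R : realType}.
Notation mu := (@lebesgue_measure R).

Lemma lipschitz_fun_continuous (phi : R -> R) (L : R) :
  (forall s t, `|phi t - phi s| <= L * `|t - s|) -> continuous phi.
Proof.
move=> philip s; apply/cvgrPdist_le => e e0.
have L1 : 0 < `|L| + 1 by rewrite ltr_wpDl.
near=> t.
rewrite distrC (le_trans (philip _ _))//.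
apply: (@le_trans _ _ ((`|L| + 1) * `|s - t|)).
  by rewrite distrC ler_wpM2r// (le_trans (ler_norm L))// lerDl.
rewrite -ler_pdivlMl//.
near: t; apply: cvgr_dist_le; first exact: cvg_id.
by rewrite mulr_gt0// invr_gt0.
Unshelve. all: by end_near. Qed.

(** Adding the linear function of slope [L] makes an [L]-Lipschitz function
    nondecreasing, hence the distribution function of a Stieltjes measure.
    The Lipschitz bound is an argument of [tilt] so that the cumulative
    structure can be inferred from the term. *)
Section Tilt.
Variables (phi : R -> R) (L : R).
Hypothesis philip : forall s t, `|phi t - phi s| <= L * `|t - s|.

Definition tilt of (forall s t, `|phi t - phi s| <= L * `|t - s|) :=
  fun t => phi t + L * t.

Let tilt_nd : nondecreasing (tilt philip).
Proof.
move=> s t st; rewrite /tilt.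
have := philip s t; rewrite ler_norml ger0_norm ?subr_ge0// => /andP[+ _].
lra.
Qed.

Let tilt_rc : right_continuous (tilt philip).
Proof.
apply: right_continuousW => t; apply: cvgD.
  exact: (lipschitz_fun_continuous philip).
by apply: cvgM; [exact: cvg_cst|exact: cvg_id].
Qed.

HB.instance Definition _ :=
  isCumulative.Build R _ R (tilt philip) tilt_nd tilt_rc.
End Tilt.

Lemma stieltjes_ocitv (F : cumulative R R) (a b : R) : a <= b ->
  lebesgue_stieltjes_measure F `]a, b] = (F b - F a)%:E.
Proof.
move=> ab; rewrite /lebesgue_stieltjes_measure /= /measure_extension/=.
rewrite measurable_mu_extE/=; last exact: is_ocitv.
by rewrite wlength_itv_bnd// EFinB.
Qed.

(** The measures tilted from [phi] and from [- phi] add up to the Stieltjes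
    measure of [2 L t], because they do so on half-open intervals; so each of
    them is at most [2 L] times the Lebesgue measure, in particular absolutely
    continuous. *)
Lemma tilt_stieltjes_le (phi : R -> R) (L : R)
    (philip : forall s t, `|phi t - phi s| <= L * `|t - s|) (A : set R) :
  measurable A -> 0 <= L ->
  (lebesgue_stieltjes_measure (tilt philip) A <= (2 * L)%:E * mu A)%E.
Proof.
move=> mA L0.
have nphilip s t : `|(- phi t) - (- phi s)| <= L * `|t - s|.
  by rewrite -opprD normrN.
have dlip s t : `|L * t - L * s| <= L * `|t - s|.
  by rewrite -mulrBr normrM (ger0_norm L0).
have L20 : 0 <= 2 * L by rewrite mulr_ge0.
pose nu1 := lebesgue_stieltjes_measure (tilt philip).
pose nu2 := lebesgue_stieltjes_measure (tilt nphilip).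
pose nu3 := lebesgue_stieltjes_measure (tilt dlip).
have E1 : nu3 A = measure_add nu1 nu2 A.
  apply: lebesgue_stieltjes_measure_unique => // _ [[a b] _ <-].
  have [ab|ba] := leP a b; last first.
    by rewrite set_itv_ge ?measure0// bnd_simp -leNgt ltW.
  rewrite [RHS]measure_addE.
  have e1 := stieltjes_ocitv (tilt philip) ab.
  have e2 := stieltjes_ocitv (tilt nphilip) ab.
  apply: (etrans _ (esym (congr2 (fun p q => (p + q)%E) e1 e2))).
  rewrite (stieltjes_ocitv (tilt dlip) ab) -EFinD; congr EFin; rewrite /= /tilt; ring.
have E2 : nu3 A = mscale (NngNum L20) mu A.
  apply: lebesgue_stieltjes_measure_unique => // _ [[a b] _ <-].
  have [ab|ba] := leP a b; last first.
    by rewrite set_itv_ge ?measure0// bnd_simp -leNgt ltW.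
  have e1 := stieltjes_ocitv (@idfun R) ab.
  apply: (etrans _ (esym (congr1 (fun p => (2 * L)%:E * p)%E e1))).
  rewrite (stieltjes_ocitv (tilt dlip) ab) -EFinM; congr EFin; rewrite /= /tilt; ring.
rewrite -/nu1.
have -> : ((2 * L)%:E * mu A)%E = nu3 A by rewrite E2.
by rewrite E1 measure_addE leeDl.
Qed.

Lemma integrable_cst_itv01 (c : R) :
  mu.-integrable `[(0 : R), 1] (EFin \o cst c).
Proof.
apply: (continuous_compact_integrable (f := cst c)).
  exact: segment_compact.
by apply: continuous_subspaceT => x; exact: cvg_cst.
Qed.

(** The density [h] of the tilted measure on [-1, 2] exists by
    Radon-Nikodym, and the Lebesgue differentiation theorem recovers it almost
    everywhere as the derivative of the tilted function. Subtracting the slope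
    gives both the derivative of [phi] and the fundamental theorem. *)
Lemma lipschitz_primitive (phi : R -> R) (L : R) :
  (forall s t, `|phi t - phi s| <= L * `|t - s|) ->
  exists u : R -> R,
  [/\ mu.-integrable `[0, 1] (EFin \o u),
      {ae mu, forall t : R, 0 < t < 1 -> is_derive t 1 phi (u t)} &
      (\int[mu]_(t in `[0%R, 1%R]) (u t)%:E)%E = (phi 1 - phi 0)%:E].
Proof.
move=> philip.
have L0 : 0 <= L.
  have := philip 0 1; rewrite subr0 normr1 mulr1; exact: le_trans.
pose psi : cumulative R R := tilt philip.
(* A bounded interval, for a finite measure, with [0, 1] in its interior. *)
pose D : set (measurableTypeR R) := `](-1 : R), (2 : R)]%classic.
have mD : measurable D by exact: measurable_itv.
have Dfin : (lebesgue_stieltjes_measure psi D < +oo)%E.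
  by rewrite stieltjes_ocitv ?ltry//; lra.
pose nu : {finite_measure set (measurableTypeR R) -> \bar R} := mfrestr mD Dfin.
have numu : nu `<< mu.
  apply/null_content_dominatesP => A mA A0.
  apply/eqP; rewrite eq_le measure_ge0 andbT /nu /mfrestr /mrestr.
  apply: (@le_trans _ _ (lebesgue_stieltjes_measure psi A)).
    by apply: (le_measure (lebesgue_stieltjes_measure psi));
      rewrite ?inE//; exact: measurableI.
  rewrite (le_trans (tilt_stieltjes_le philip mA L0))//.
  by rewrite A0 mule0.
have [h [h0 hfin hint hE]] := @radon_nikodym_sigma_finite _ _ R mu nu numu.
pose h' : R -> R := fine \o h.
have h'E : EFin \o h' = h by apply/funext => t; rewrite /h' /= fineK.
have h'int : mu.-integrable setT (EFin \o h') by rewrite h'E.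
have nuE (a b : R) : -1 <= a -> a <= b -> b <= 2 ->
    nu `]a, b]%classic = (psi b - psi a)%:E.
  move=> a1 ab b2; rewrite -(stieltjes_ocitv psi ab).
  apply: (congr1 (lebesgue_stieltjes_measure psi)); apply: setIidl => //.
  by apply: set_interval.subset_itv; rewrite bnd_simp.
have FE (x : R) : -1 < x < 2 ->
    (\int[mu]_(t in [set` `](-1 : R), x]]) h' t)%R = psi x - psi (-1).
  move=> /andP[x1 x2]; rewrite /Rintegral.
  under eq_integral do rewrite fineK//.
  rewrite -hE; last exact: measurable_itv.
  by rewrite nuE// ltW.
have := @FTC1 R h' (BRight (-1)) _ _.
have h'loc : locally_integrable setT h'.
  by apply: open_integrable_locally => //; exact: openT.
have h'int' (y : R) : mu.-integrable `](-1 : R), y] (EFin \o h').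
  apply: (integrableS measurableT) => //; exact: measurable_itv.
move=> /(_ h'int' h'loc) /= ftc.
exists (fun t => h' t - L); split.
- rewrite (_ : _ \o _ = (EFin \o h') \- cst L%:E)%E; last first.
    by apply/funext => t /=; rewrite EFinB.
  apply: integrableB => //=; last exact: integrable_cst_itv01.
    apply: (integrableS measurableT) => //; exact: measurable_itv.
- apply: filterS ftc; first exact: (ae_filter_ringOfSetsType mu).
  move=> t tF /andP[t0 t1].
  have /tF[dF F'E] : (BRight (-1) < BRight t)%O by rewrite bnd_simp; lra.
  have isF : is_derive t 1 (fun x => \int[mu]_(t0 in [set` `](-1 : R), x]]) h' t0)%R (h' t).
    apply: DeriveDef; [exact: dF|rewrite -derive1E; exact: F'E].
  have : is_derive t 1 (fun x => psi x - psi (-1)) (h' t).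
    apply: near_eq_is_derive isF; near=> x; rewrite FE//.
    have : x \in `]-1, 2[ by near: x; apply: near_in_itvoo; rewrite in_itv/=; lra.
    by rewrite in_itv.
  move=> ispsi.
  have -> : phi = (fun x => (psi x - psi (-1)) - (L * x - psi (-1))).
    by apply/funext => x; rewrite /psi /= /tilt; ring.
  apply: is_deriveB.
  rewrite -[X in is_derive _ _ _ X]subr0; apply: is_deriveB.
  have := @is_deriveZ R R R id L t 1 1 _.
  rewrite /GRing.scale /= mulr1; apply; exact: is_derive_id.
- under eq_integral do rewrite EFinB.
  have mI : measurable (`[0, 1]%classic : set (measurableTypeR R)).
    exact: measurable_itv.
  rewrite integralB//=; last 2 first.
  + exact: (integrableS measurableT).
  + exact: integrable_cst_itv01.
  have mu01 : mu `[(0 : R), 1]%classic = 1%E.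
    by rewrite lebesgue_measure_itv/= lte_fin ltr01 oppr0 adde0.
  rewrite integral_cst// [X in (_ * X)%E]mu01 mule1.
  rewrite -integral_itv_obnd_cbnd; last first.
    apply: (measurable_int mu).
    by apply: (integrableS measurableT) => //; exact: measurable_itv.
  under eq_integral do rewrite fineK//.
  rewrite -hE; last exact: measurable_itv.
  rewrite nuE ?lerN10 ?ler01 ?ler1n// -EFinB /psi /= /tilt; congr EFin; ring.
Unshelve. all: by end_near. Qed.
End LipschitzPrimitive.

(** * Inner product, norms and separation in R^n *)

Section EuclideanGeometry.
Context {R : realType} {n : nat}.
Implicit Types (u v w x y : 'rV[R]_n) (A : set 'rV[R]_n).

Lemma dotvC u v : dotv u v = dotv v u.
Proof. by apply: eq_bigr => i _; rewrite mulrC. Qed.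

Lemma dotvDl u v w : dotv (u + v) w = dotv u w + dotv v w.
Proof. by rewrite -big_split; apply: eq_bigr => i _; rewrite mxE mulrDl. Qed.

Lemma dotvZl a u w : dotv (a *: u) w = a * dotv u w.
Proof. by rewrite mulr_sumr; apply: eq_bigr => i _; rewrite mxE mulrA. Qed.

Lemma dotvDr u v w : dotv w (u + v) = dotv w u + dotv w v.
Proof. by rewrite dotvC dotvDl !(dotvC w). Qed.

Lemma dotvZr a u w : dotv w (a *: u) = a * dotv w u.
Proof. by rewrite dotvC dotvZl (dotvC w). Qed.

Lemma dotvNl u w : dotv (- u) w = - dotv u w.
Proof. by rewrite -scaleN1r dotvZl mulN1r. Qed.

Lemma dotvNr u w : dotv w (- u) = - dotv w u.
Proof. by rewrite dotvC dotvNl (dotvC w). Qed.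

Lemma dotvBl u v w : dotv (u - v) w = dotv u w - dotv v w.
Proof. by rewrite dotvDl dotvNl. Qed.

Lemma dotvBr u v w : dotv w (u - v) = dotv w u - dotv w v.
Proof. by rewrite dotvDr dotvNr. Qed.

Lemma dotv0l w : dotv 0 w = 0.
Proof. by rewrite -(scale0r w) dotvZl mul0r. Qed.

Lemma dotv0r w : dotv w 0 = 0.
Proof. by rewrite dotvC dotv0l. Qed.

Lemma dotv_sumr I (r : seq I) (Q : pred I) (F : I -> 'rV[R]_n) w :
  dotv w (\sum_(i <- r | Q i) F i) = \sum_(i <- r | Q i) dotv w (F i).
Proof.
elim/big_rec2 : _ => [|i a b _ <-]; first exact: dotv0r.
by rewrite dotvDr.
Qed.

Lemma normr_coord_le u i : `|u 0 i| <= `|u|.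
Proof.
rewrite [leRHS]/Num.norm /= mx_normrE.
by apply/bigmax_geP; right => /=; exists (0, i).
Qed.

Lemma normr_rV_le u c : 0 <= c -> (forall i, `|u 0 i| <= c) -> `|u| <= c.
Proof.
move=> c0 uc; rewrite [leLHS]/Num.norm /= mx_normrE.
by apply/bigmax_leP; split => // -[i j] _ /=; rewrite (ord1 i).
Qed.

Lemma dotvv_ge0 u : 0 <= dotv u u.
Proof. by apply: sumr_ge0 => i _; rewrite -expr2 sqr_ge0. Qed.

Lemma normr_sqr_le_dotvv u : `|u| ^+ 2 <= dotv u u.
Proof.
have uu i : `|u 0 i| <= Num.sqrt (dotv u u).
  rewrite -sqrtr_sqr ler_wsqrtr// /dotv (bigD1 i)//= -expr2 lerDl.
  by apply: sumr_ge0 => j _; rewrite -expr2 sqr_ge0.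
rewrite -[leRHS](sqr_sqrtr (dotvv_ge0 u)).
by rewrite ler_sqr ?nnegrE ?sqrtr_ge0// normr_rV_le ?sqrtr_ge0.
Qed.

Lemma dotvv_eq0 u : (dotv u u == 0) = (u == 0).
Proof.
apply/eqP/eqP => [u0|->]; last exact: dotv0l.
apply/eqP; rewrite -normr_eq0 -sqrf_eq0 eq_le sqr_ge0 andbT -u0.
exact: normr_sqr_le_dotvv.
Qed.

Lemma normr_dotv_le u v : `|dotv u v| <= n%:R * (`|u| * `|v|).
Proof.
rewrite (le_trans (ler_norm_sum _ _ _))//.
have -> : n%:R * (`|u| * `|v|) = \sum_(i < n) (`|u| * `|v|).
  by rewrite sumr_const card_ord mulr_natl.
rewrite ler_sum// => i _.
by rewrite normrM ler_pM ?normr_ge0// normr_coord_le.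
Qed.

Lemma normr_le_enorm u : `|u| <= enorm u.
Proof.
rewrite -(@ler_sqr _ `|u|) ?nnegrE ?sqrtr_ge0// sqr_sqrtr ?dotvv_ge0//.
exact: normr_sqr_le_dotvv.
Qed.

Lemma enorm_le_normr u : enorm u <= n%:R * `|u|.
Proof.
rewrite -(@ler_sqr _ (enorm u)) ?nnegrE ?sqrtr_ge0 ?mulr_ge0//.
rewrite sqr_sqrtr ?dotvv_ge0// (le_trans (ler_norm _))//.
rewrite (le_trans (normr_dotv_le u u))// exprMn -expr2 ler_wpM2r ?sqr_ge0//.
by rewrite -natrX ler_nat; case: (n) => // k; rewrite leq_pmulr.
Qed.

Lemma cvg_dotv T (F : set_system T) {FF : Filter F} (f g : T -> 'rV[R]_n) u v :
  f t @[t --> F] --> u -> g t @[t --> F] --> v ->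
  dotv (f t) (g t) @[t --> F] --> dotv u v.
Proof.
move=> fu gv; rewrite /dotv; apply: cvg_big => [|i _]; first exact: add_continuous.
have cc (w : 'rV[R]_n) : (fun M : 'rV[R]_n => M 0 i) M @[M --> w] --> w 0 i.
  exact: coord_continuous.
by apply: cvgM; [apply: (cvg_comp _ _ fu (cc u))|apply: (cvg_comp _ _ gv (cc v))].
Qed.

Lemma convex_setP A u v t : @convex_set R 'rV[R]_n A -> A u -> A v ->
  0 <= t <= 1 -> A (u + t *: (v - u)).
Proof.
move=> cA Au Av t01.
have := cA v u (Itv01 (andP t01).1 (andP t01).2) (mem_set Av) (mem_set Au).
rewrite inE /= => ?.
suff -> : u + t *: (v - u) = t *: v + (1 - t) *: u by [].
by rewrite scalerBr scalerBl scale1r; rewrite addrCA addrA.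
Qed.

(** Take for [v0] the point of [A] nearest to [u]; the first-order condition
    along the segments from [v0] says that [A] lies behind the hyperplane
    through [v0] orthogonal to [u - v0]. *)
Lemma convex_compact_separation A u : A !=set0 -> compact A ->
  @convex_set R 'rV[R]_n A -> ~ A u ->
  exists2 v0, A v0 & u - v0 != 0 /\ forall v, A v ->
    dotv (u - v0) v <= dotv (u - v0) u - dotv (u - v0) (u - v0).
Proof.
move=> A0 cA cvA Au.
have cf : {within A, continuous (fun v => dotv (u - v) (u - v))}.
  apply: continuous_subspaceT.
  suff cd (v : 'rV[R]_n) : dotv (u - w) (u - w) @[w --> v] --> dotv (u - v) (u - v).
    exact: cd.
  have uv : u - w @[w --> v] --> u - v.
    exact: (@cvgB _ _ _ (nbhs v) _ (cst u) id _ _ (cvg_cst u) (cvg_id (F := nbhs v))).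
  exact: (@cvg_dotv _ (nbhs v) _ _ _ _ _ uv uv).
have [v0 /set_mem Av0 minv0] := compact_EVT_min A0 cA cf.
exists v0 => //; split.
  by rewrite subr_eq0; apply: contra_notN Au => /eqP ->.
have [q qE] : exists q, q = u - v0 by exists (u - v0).
rewrite -qE => v Av.
have [w wE] : exists w, w = v - v0 by exists (v - v0).
have key t : 0 < t <= 1 -> 2 * dotv q w <= t * dotv w w.
  move=> /andP[t0 t1].
  have At : A (v0 + t *: w) by rewrite wE; apply: convex_setP => //; rewrite (ltW t0).
  have := minv0 _ (mem_set At).
  have -> : u - (v0 + t *: w) = q - t *: w by rewrite opprD addrA qE.
  rewrite -qE dotvBl !dotvBr !dotvZl !dotvZr (dotvC w q) => h.
  have : t * (2 * dotv q w) <= t * (t * dotv w w) by lra.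
  by rewrite ler_pM2l.
have : dotv q w <= 0.
  rewrite leNgt; apply/negP => a0.
  set a := dotv q w in a0 key; set b := dotv w w in key.
  have b0 : 0 < b.
    rewrite lt_neqAle dotvv_ge0 andbT eq_sym dotvv_eq0.
    by apply: contraTneq a0; rewrite /a => ->; rewrite dotv0r ltxx.
  (* The parameter a / b, capped at 1, contradicts [key]. *)
  have [ab|ba] := leP a b.
    have := key (a / b); rewrite divr_gt0//= ler_pdivrMr// mul1r => /(_ ab).
    by rewrite divfK ?gt_eqF//; lra.
  by have := key 1; rewrite ltr01 lexx => /(_ isT); lra.
rewrite wE dotvBr => h.
have : dotv q u - dotv q v0 = dotv q q by rewrite -dotvBr -qE.
lra.
Qed.

End EuclideanGeometry.

(** * Integrals of functions with an integrable minorant *)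

Section IntegralMinorant.
Context d (T : measurableType d) (R : realType).
Variable mu : {measure set T -> \bar R}.
Local Open Scope ereal_scope.

(** The integral of a nonnegative function, measurable or not, is a supremum
    over the simple functions below it. *)
Lemma ge0_le_integral_arbitrary (D : set T) (f g : T -> \bar R) :
  (forall x, D x -> 0 <= f x) -> (forall x, D x -> f x <= g x) ->
  \int[mu]_(x in D) f x <= \int[mu]_(x in D) g x.
Proof.
move=> f0 fg.
have g0 x : D x -> 0 <= g x by move=> Dx; exact: le_trans (f0 _ Dx) (fg _ Dx).
rewrite !ge0_integralE//; apply: ereal_sup_le.
apply: image_subset => h /= hf x; apply: le_trans (hf x) _.
by rewrite !patchE; case: ifPn => // /set_mem /fg.
Qed.

(** This serves to bound path integrals from below, where [F] is a supremum over
    the values of a set-valued field. On the exceptional null set the minorant is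
    changed to [0] in its positive part and to [+oo] in its negative part, which
    does not affect its integral. *)
Lemma ae_le_integral_arbitrary (D : set T) (h F : T -> \bar R) :
  measurable D -> mu.-integrable D h ->
  {ae mu, forall x, D x -> h x <= F x} ->
  \int[mu]_(x in D) h x <= \int[mu]_(x in D) F x.
Proof.
move=> mD hint [N [mN N0 hFN]].
have hF x : D x -> x \notin N -> h x <= F x.
  move=> Dx; rewrite notin_setE => Nx; apply: contrapT => hFx; apply: Nx.
  by apply: hFN => /= /(_ Dx).
have mh := measurable_int mu hint.
have mNb : measurable_fun D (fun x => x \in N).
  apply: (measurable_fun_bool true).
  rewrite (_ : _ @^-1` _ = N); first exact: measurableI.
  by apply/seteqP; split => x /=; [move/set_mem|move/mem_set].
have aeif (g k : T -> \bar R) : {ae mu, forall x, D x -> (if x \in N then g x else k x) = k x}.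
  exists N; split => // x /= /not_implyP[_]; case: ifPn => // /set_mem//.
rewrite integralE [leRHS]integralE; apply: leeB.
- pose h1 x : \bar R := if x \in N then 0 else h^\+ x.
  have mh1 : measurable_fun D h1.
    apply: measurable_fun_if => //.
    by apply: measurable_funS (measurable_funepos mh) => // ? [].
  rewrite -(@ge0_ae_eq_integral _ _ _ mu D h1 (h^\+)) //; last 3 first.
  + exact: measurable_funepos.
  + by move=> x _; rewrite /h1; case: ifP.
  + exact: aeif.
  apply: ge0_le_integral_arbitrary => x Dx; rewrite /h1; case: ifPn => // xN.
  by rewrite !funeposE ge_max !le_max hF// lexx orbT.
- pose h2 x : \bar R := if x \in N then +oo else h^\- x.
  have mh2 : measurable_fun D h2.
    apply: measurable_fun_if => //.
    by apply: measurable_funS (measurable_funeneg mh) => // ? [].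
  rewrite -(@ge0_ae_eq_integral _ _ _ mu D h2 (h^\-)) //; last 3 first.
  + exact: measurable_funeneg.
  + by move=> x _; rewrite /h2; case: ifP => //; rewrite leey.
  + exact: aeif.
  apply: ge0_le_integral_arbitrary => x Dx //; rewrite /h2; case: ifPn => xN.
    by rewrite leey.
  by rewrite !funenegE ge_max !le_max leeN2 hF// lexx orbT.
Qed.

End IntegralMinorant.

(** * Conservative fields are locally bounded and upper semicontinuous *)

Section FieldRegularity.
Context {R : realType} {n : nat}.
Implicit Types (D : 'rV[R]_n -> set 'rV[R]_n) (x y v : 'rV[R]_n).

(** Neighbourhoods of matrices are generated entrywise; this is their metric
    form. *)
Lemma nbhs_rVP x (V : set 'rV[R]_n) :
  nbhs x V <-> exists2 r : R, 0 < r & forall y, `|y - x| < r -> V y.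
Proof.
split=> [/nbhs_normP[r /= r0 xr]|[r r0 xr]].
  by exists r => // y yx; apply: xr => /=; rewrite distrC.
by apply: (nbhs_normP x V).2; exists r => // y /= yx; apply: xr; rewrite distrC.
Qed.

(** A tube lemma: the compact set [K] is covered by finitely many open boxes
    of the complement of the graph. *)
Lemma closed_graph_avoid D x (K : set 'rV[R]_n) :
  closed [set p : 'rV[R]_n * 'rV[R]_n | D p.1 p.2] -> compact K ->
  (forall v, K v -> ~ D x v) ->
  exists2 r, 0 < r & forall y, `|y - x| < r -> forall v, K v -> ~ D y v.
Proof.
move=> cD cK KD.
have : \forall y \near x, K `<=` (fun v => ~ D y v).
  have := (compact_near_coveringP K).1 cK _ (nbhs x) (fun y v => ~ D y v) _.
  apply => v Kv.
  have oG : open (~` [set p : 'rV[R]_n * 'rV[R]_n | D p.1 p.2]) by exact: closed_openC.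
  have : nbhs (x, v) (~` [set p : 'rV[R]_n * 'rV[R]_n | D p.1 p.2]).
    by apply: open_nbhs_nbhs; split => //; exact: KD.
  case=> -[A B] /= [nA nB] AB.
  exists (B, A) => // -[v' x'] /= [Bv' Ax'].
  exact: (AB (x', v')).
move=> nK; have /nbhs_normP[r /= r0 xr] := nK.
exists r => // y yx v Kv.
by apply: xr => //=; rewrite distrC.
Qed.

Lemma sphere_compact (rho : R) : compact [set v : 'rV[R]_n | `|v| = rho].
Proof.
apply: bounded_closed_compact.
  by exists rho; split; [exact: num_real|move=> M rM v /= ->; exact: ltW].
exact: ((continuous_closedP (@Num.norm R 'rV[R]_n)).1 (@norm_continuous R 'rV[R]_n) _ (@closed_eq R rho)).
Qed.

Lemma closed_ball0_compact (rho : R) : compact [set v : 'rV[R]_n | `|v| <= rho].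
Proof.
apply: bounded_closed_compact.
  by exists rho; split; [exact: num_real|move=> M rM v /= /le_trans; apply; exact: ltW].
exact: ((continuous_closedP (@Num.norm R 'rV[R]_n)).1 (@norm_continuous R 'rV[R]_n) _ (@closed_le R rho)).
Qed.

Lemma convex_meets_sphere (A : set 'rV[R]_n) u v rho :
  @convex_set R 'rV[R]_n A -> A u -> A v -> `|u| < rho -> rho <= `|v| ->
  exists2 w, A w & `|w| = rho.
Proof.
move=> cA Au Av ur rv.
pose h (t : R) := `|u + t *: (v - u)|.
have hlip (s t : R) : `|h t - h s| <= `|v - u| * `|t - s|.
  rewrite (le_trans (ler_dist_dist _ _))//.
  by rewrite opprD addrACA subrr add0r -scalerBl normrZ mulrC.
have hc : {within `[0, 1], continuous h}.
  by apply: continuous_subspaceT; exact: (lipschitz_fun_continuous hlip).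
have [|t] := @IVT R h 0 1 rho ler01 hc.
  rewrite /h scale0r addr0 scale1r addrC subrK.
  have uv : `|u| <= `|v| by rewrite (le_trans (ltW ur)).
  by rewrite min_l// max_r// rv (ltW ur).
rewrite in_itv /= => t01 ht; exists (u + t *: (v - u)) => //.
exact: convex_setP.
Qed.

Lemma locally_lipschitz_ball (f : 'rV[R]_n -> R) x : locally_lipschitz f ->
  exists2 L, 0 <= L & exists2 r, 0 < r & forall y z,
    `|y - x| < r -> `|z - x| < r -> `|f y - f z| <= L * `|y - z|.
Proof.
move=> /(_ x)[U /nbhs_normP[r /= r0 xU] [M [Mr fM]]].
exists (`|M| + 1); first by rewrite addr_ge0.
exists r => // y z yx zx.
have := fM (`|M| + 1); rewrite (le_lt_trans (ler_norm _)) ?ltrDl//.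
move=> /(_ isT (y, z)); apply; split; apply: xU => /=; by rewrite distrC.
Qed.

End FieldRegularity.

Section LipschitzCurves.
Context {R : realType} {n : nat}.
Implicit Types (D : 'rV[R]_n -> set 'rV[R]_n) (f : 'rV[R]_n -> R).
Implicit Types (x y v u : 'rV[R]_n) (gamma : R -> 'rV[R]_n).
Notation mu := (@lebesgue_measure R).

Lemma lipschitz_abs_continuous gamma (L : R) :
  (forall s t, `|gamma t - gamma s| <= L * `|t - s|) -> abs_continuous01 gamma.
Proof.
move=> glip e e0.
have L0 : 0 <= L.
  by have := glip 0 1; rewrite subr0 normr1 mulr1; exact: le_trans.
have C0 : 0 < n%:R * L + 1 by rewrite ltr_wpDl// mulr_ge0.
exists (e / (n%:R * L + 1)); first by rewrite divr_gt0.
move=> N a b ab _; rewrite ltr_pdivlMr// => sumab.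
apply: le_lt_trans sumab; rewrite mulr_suml ler_sum// => i _.
have [_ abi _] := ab i.
rewrite (le_trans (enorm_le_normr _))//.
apply: (@le_trans _ _ (n%:R * (L * (b i - a i)))).
  by rewrite ler_wpM2l// (le_trans (glip _ _))// ger0_norm// subr_ge0.
by rewrite mulrA mulrC ler_wpM2l ?subr_ge0// lerDl.
Qed.

Lemma dotv_le_max_dot D x u v : compact (D x) -> D x v ->
  dotv u v <= max_dot D x u.
Proof.
move=> cD Dv; apply: sup_ubound; last by exists v.
have [M [_ MD]] := compact_bounded cD.
exists (n%:R * (`|u| * (`|M| + 1))) => _ [w Dw <-].
rewrite (le_trans (ler_norm _))// (le_trans (normr_dotv_le _ _))//.
rewrite ler_wpM2l// ler_wpM2l// MD// (le_lt_trans (ler_norm _))// ltrDl//.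
Qed.

(** The chain rule for [f] along [gamma], used in one direction only: an
    almost everywhere minorant of the integrand bounds the increment of [f]. *)
Lemma potential_increment_ge f D gamma (h : R -> R) (c : R) :
  potential f D -> abs_continuous01 gamma ->
  mu.-integrable `[0, 1] (EFin \o h) ->
  {ae mu, forall t : R, 0 < t < 1 -> h t <= max_dot D (gamma t) (derive1 gamma t)} ->
  (\int[mu]_(t in `[0%R, 1%R]) (h t)%:E = c%:E)%E ->
  c <= f (gamma 1) - f (gamma 0).
Proof.
move=> pot gac hint hle hc.
have := pot _ gac; rewrite /path_integral => fE.
have : (c%:E <= path_integral D gamma)%E.
  rewrite -hc /path_integral; apply: ae_le_integral_arbitrary => //.
  have ne (r : R) : {ae mu, forall t : R, t <> r}.
    exists [set r]; split; [exact: measurable_set1|exact: lebesgue_measure_set1|].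
    by move=> t /= /contrapT.
  move: hle (ne 0) (ne 1).
  apply: (@filterS3 _ _ (ae_filter_ringOfSetsType mu)) => t /= ht t0 t1.
  rewrite in_itv /= => /andP[t0' t1']; rewrite lee_fin; apply: ht.
  by rewrite !lt_neqAle t0' t1' !andbT; apply/andP; split; apply/eqP => // /esym.
move: fE; rewrite -/(path_integral D gamma).
case: (path_integral D gamma) => [r| |] //.
rewrite -EFinD => -[->]; rewrite lee_fin; lra.
Qed.

End LipschitzCurves.

(** Records the join of completeness and normed module structures, needed to
    apply the Baire theorem. *)
HB.instance Definition _ (R : realType) (m n : nat) := Complete.on 'M[R]_(m, n).

(** A closed graph with compact values does not imply local boundedness: the
    real field with value [{1/x}] at [x <> 0] and [{0}] at [0] is a
    counterexample. It is the chain rule for a Lipschitz potential that excludes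
    such behaviour. *)
Section LocalBoundedness.
Context {R : realType} {n : nat}.
Variables (f : 'rV[R]_n -> R) (D : 'rV[R]_n -> set 'rV[R]_n).
Hypothesis flip : locally_lipschitz f.
Hypothesis Dclosed : closed [set p : 'rV[R]_n * 'rV[R]_n | D p.1 p.2].
Hypothesis Dneq0 : forall x, D x !=set0.
Hypothesis Dcompact : forall x, compact (D x).
Hypothesis Dconvex : forall x, @convex_set R 'rV[R]_n (D x).
Hypothesis fpot : potential f D.
Notation mu := (@lebesgue_measure R).

Let locally_bounded_at (x : 'rV[R]_n) :=
  exists2 rho : R, 0 < rho & exists2 r : R, 0 < r & forall y : 'rV[R]_n, `|y - x| < r -> forall v, D y v -> `|v| <= rho.

(** Apply the tube lemma to the bounded values at distance at least [e] from
    [D x], which form a compact set that [D x] avoids. *)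
Lemma locally_bounded_usc x (e : R) : locally_bounded_at x -> 0 < e ->
  exists2 r, 0 < r & forall y, `|y - x| < r -> forall v, D y v ->
    exists2 w, D x w & `|v - w| < e.
Proof.
move=> [rho rho0 [r r0 xrho]] e0.
pose K := [set v : 'rV[R]_n | `|v| <= rho] `&`
          ~` \bigcup_(w in D x) [set v | `|v - w| < e].
have cK : compact K.
  apply: compact_closedI; first exact: closed_ball0_compact.
  apply: open_closedC; apply: bigcup_open => w _.
  have -> : [set v | `|v - w| < e] = ball w e.
    by apply/seteqP; split => v; rewrite -ball_normE /= distrC.
  exact: ball_open.
have KD v : K v -> ~ D x v.
  by move=> [_ Kv] Dv; apply: Kv; exists v => //=; rewrite subrr normr0.
have [r' r'0 xK] := closed_graph_avoid Dclosed cK KD.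
exists (Num.min r r'); first by rewrite lt_min r0.
move=> y; rewrite lt_min => /andP[yr yr'] v Dv.
apply: contrapT => nw; apply: (xK y yr' v) => //; split; first exact: xrho yr _ Dv.
by move=> [w Dw /= vw]; apply: nw; exists w.
Qed.

Lemma value_bounded x : exists2 M, 0 < M & forall v, D x v -> `|v| < M.
Proof.
have [M [_ MD]] := compact_bounded (@Dcompact x).
exists (`|M| + 2); first by rewrite ltr_wpDl.
move=> v Dv; apply: (@le_lt_trans _ _ (`|M| + 1)); last by rewrite ltrD2l ltr1n.
by apply: MD => //; rewrite (le_lt_trans (ler_norm _))// ltrDl.
Qed.

(** Near [x] the values avoid a sphere whose radius exceeds [m]. A convex set
    avoiding a sphere lies inside or outside of it, and the values near [x] have
    an element inside. *)
Lemma locally_bounded_of_small_elements x (m r : R) : 0 < r ->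
  (forall y, `|y - x| < r -> exists2 v, D y v & `|v| <= m) ->
  locally_bounded_at x.
Proof.
move=> r0 xm.
have [M M0 MD] := value_bounded x.
pose rho := Num.max M (m + 1).
have [v|r' r'0 xr'] := @closed_graph_avoid R n D x [set v | `|v| = rho] Dclosed
  (@sphere_compact R n rho).
  move=> /= vrho Dv; have := MD _ Dv; rewrite vrho /rho.
  by rewrite gt_max ltxx.
exists rho; first by rewrite lt_max M0.
exists (Num.min r r'); first by rewrite lt_min r0.
move=> y; rewrite lt_min => /andP[yr yr'] v Dv.
rewrite leNgt; apply/negP => rhov.
have [u Du um] := xm _ yr.
have urho : `|u| < rho by rewrite lt_max; apply/orP; right; rewrite (le_lt_trans um)// ltrDl.
have [w Dw wrho] := convex_meets_sphere (@Dconvex y) Du Dv urho (ltW rhov).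
exact: (xr' y yr' w).
Qed.

Let derive1_line (y u : 'rV[R]_n) (t : R) : derive1 (fun s : R => y + s *: u) t = u.
Proof.
rewrite derive1E; apply/cvg_lim => //; apply: cvg_near_cst.
near=> h; rewrite opprD addrACA subrr add0r -scalerBl addrK.
rewrite (_ : h%:A = h) ?[_%:A]mulr1// scalerA mulVf ?scale1r//.
by near: h; exact: nbhs_dnbhs_neq.
Unshelve. all: by end_near. Qed.

Let segment_increment_ge (y u : 'rV[R]_n) (c : R) :
  (forall t v, 0 < t < 1 -> D (y + t *: u) v -> c <= dotv u v) ->
  c <= f (y + u) - f y.
Proof.
move=> cD; pose gamma (t : R) := y + t *: u.
have glip (s t : R) : `|gamma t - gamma s| <= `|u| * `|t - s|.
  by rewrite /gamma opprD addrACA subrr add0r -scalerBl normrZ mulrC.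
have := @potential_increment_ge R n f D gamma (cst c) c fpot
  (lipschitz_abs_continuous glip) (integrable_cst_itv01 c).
rewrite /gamma scale1r scale0r addr0; apply.
- apply: aeW => t t01; have [v Dv] := @Dneq0 (y + t *: u).
  rewrite derive1_line; apply: le_trans (dotv_le_max_dot _ (@Dcompact _) Dv).
  exact: cD Dv.
- have mu01 : mu `[(0 : R), 1]%classic = 1%E.
    by rewrite lebesgue_measure_itv/= lte_fin ltr01 oppr0 adde0.
  by rewrite /= integral_cst// [X in (_ * X)%E]mu01 mule1.
Qed.

(** Choose a sphere that contains [D x] and whose radius exceeds twice the
    Lipschitz constant of [f] near [x]. Values near [x] avoid it, so they lie
    inside or outside; the points [V] whose value lies outside form an open set.
    If [V] is nonempty, Baire's theorem, applied to the closed sets [A m] of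
    points whose value meets the ball of radius [m], yields a point [y1] of [V]
    near which the values meet a fixed ball, so that the field is upper
    semicontinuous at [y1]. Along the direction of the element [v0] of least
    norm of [D y1] the potential then grows faster than its Lipschitz constant
    allows. *)
Lemma conservative_locally_bounded x : locally_bounded_at x.
Proof.
have [L L0 [r1 r10 fL]] := locally_lipschitz_ball x flip.
have [M M0 MD] := value_bounded x.
pose rho := Num.max M (2 * L + 1).
have [v|r2 r20 xr2] := @closed_graph_avoid R n D x [set v | `|v| = rho] Dclosed
  (@sphere_compact R n rho).
  by move=> /= vrho Dv; have := MD _ Dv; rewrite vrho /rho gt_max ltxx.
pose r := Num.min r1 r2.
have r0 : 0 < r by rewrite lt_min r10.
exists rho; first by rewrite lt_max M0.
exists r => // y0 y0r v0' Dv0'; rewrite leNgt; apply/negP => rhov0'.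
pose V := [set y | `|y - x| < r /\ exists2 v, D y v & rho < `|v|].
have Vfar y v : V y -> D y v -> rho < `|v|.
  move=> [yr [w Dw rhow]] Dv; rewrite ltNge; apply/negP => vrho.
  have yr2 : `|y - x| < r2 by move: yr; rewrite lt_min => /andP[].
  move: vrho; rewrite le_eqVlt => /orP[/eqP vrho|vrho]; first exact: (xr2 y yr2 v).
  have [u Du urho] := convex_meets_sphere (@Dconvex y) Dv Dw vrho (ltW rhow).
  exact: (xr2 y yr2 u).
pose A (m : nat) := [set y | exists2 v, D y v & `|v| <= m%:R].
pose E := \bigcup_j (A j)°.
have avoid y (c : R) : (forall v, D y v -> c < `|v|) ->
    exists2 s, 0 < s & forall z, `|z - y| < s -> forall v, D z v -> c < `|v|.
  move=> yc.
  have [v|s s0 ys] := @closed_graph_avoid R n D y [set v | `|v| <= c] Dclosed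
    (@closed_ball0_compact R n c).
    by move=> /= vc /yc; rewrite ltNge vc.
  exists s => // z zy v Dv; rewrite ltNge; apply/negP => vc.
  exact: ys zy _ vc Dv.
have openV : open V.
  rewrite openE => y Vy; have [s s0 ys] := avoid _ _ (fun v => @Vfar y v Vy).
  have [yr _] := Vy.
  suff nV : nbhs y V by exact: nV.
  apply/nbhs_rVP; exists (Num.min s (r - `|y - x|)) => /=.
    by rewrite lt_min s0 subr_gt0.
  move=> z /=; rewrite lt_min => /andP[zs zr]; split.
    rewrite -(subrK y z) -addrA (le_lt_trans (ler_normD _ _))//.
    by rewrite -ltrBrDr.
  by have [v Dv] := Dneq0 z; exists v => //; exact: ys zs _ Dv.
(* Every point is in some [A m], so the intersection of the dense open sets
   [O m] is contained in [E]. *)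
pose O m := ~` A m `|` E.
have OE m : open (O m) /\ dense (O m).
  split.
    apply: openU; last by apply: bigcup_open => j _; exact: open_interior.
    rewrite openE => y nA.
    have [|s s0 ys] := avoid y m%:R.
      by move=> v Dv; rewrite ltNge; apply/negP => vm; apply: nA; exists v.
    suff nA' : nbhs y (~` A m) by exact: nA'.
    apply/nbhs_rVP; exists s => //= z /= zs [v Dv vm].
    by have := ys z zs v Dv; rewrite ltNge vm.
  move=> W [y Wy] oW.
  have [WA|/existsNP[z /not_implyP[Wz nAz]]] := pselect (forall z, W z -> A m z).
    exists y; split => //; right; exists m => //.
    by apply: (@filterS _ (nbhs y) _ W) => //; exact: open_nbhs_nbhs.
  by exists z; split => //; left.
have [y1 [Vy1 Oy1]] : V `&` \bigcap_i O i !=set0.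
  have dO := @Baire R 'rV[R]_n O OE; apply: (dO V) => //.
  by exists y0; split => //; exists v0'.
have [j _ Aj] : E y1.
  have [v Dv] := Dneq0 y1.
  have [nA|//] := Oy1 (Num.bound `|v|) I.
  by exfalso; apply: nA; exists v => //; rewrite ltW// archi_boundP.
have [s s0 y1s] := (nbhs_rVP _ _).1 Aj.
have y1b : locally_bounded_at y1.
  apply: (@locally_bounded_of_small_elements y1 j%:R s s0) => y ys.
  exact: y1s.
have ND0 : ~ D y1 0.
  move=> /(Vfar _ _ Vy1); rewrite normr0 ltNge => /negP; apply.
  by rewrite le_max (ltW M0).
have [v0 Dv0 [_]] := convex_compact_separation (Dneq0 y1) (@Dcompact y1)
  (@Dconvex y1) ND0.
rewrite sub0r !dotvNl dotvNr dotv0r opprK oppr0 sub0r => v0min.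
have v0rho : rho < `|v0| := Vfar _ _ Vy1 Dv0.
have v0gt0 : 0 < `|v0| by rewrite (le_lt_trans _ v0rho)// le_max (ltW M0).
have v02 : 0 < dotv v0 v0.
  by rewrite (lt_le_trans _ (normr_sqr_le_dotvv v0))// exprn_gt0.
have C0 : 0 < 2 * (n%:R * `|v0| + 1).
  by rewrite mulr_gt0// ltr_wpDl// mulr_ge0.
pose e := dotv v0 v0 / (2 * (n%:R * `|v0| + 1)).
have e0 : 0 < e by rewrite divr_gt0.
have [r3 r30 y1usc] := locally_bounded_usc y1b e0.
(* Half of the least squared norm survives near [y1] by semicontinuity. *)
have v0half y v : `|y - y1| < r3 -> D y v -> dotv v0 v0 / 2 <= dotv v0 v.
  move=> yr Dv; have [w Dw vw] := y1usc _ yr _ Dv.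
  have /(_ w Dw) := v0min; rewrite dotvNl lerN2 => v0w.
  have : `|dotv v0 (v - w)| <= dotv v0 v0 / 2.
    rewrite (le_trans (normr_dotv_le _ _))//.
    apply: (@le_trans _ _ ((n%:R * `|v0| + 1) * e)).
      by rewrite mulrA ler_pM ?mulr_ge0// ?lerDl// ltW.
    have C0' : n%:R * `|v0| + 1 != 0 by rewrite gt_eqF// ltr_wpDl// mulr_ge0.
    rewrite (_ : _ * e = dotv v0 v0 / 2)// /e.
    move: C0'; set C := _ + 1 => C0'; field; exact: C0'.
  rewrite dotvBr ler_norml => /andP[]; lra.
have [y1x _] := Vy1.
pose s1 := Num.min r3 (r - `|y1 - x|) / (`|v0| + 1).
have v01 : 0 < `|v0| + 1 by rewrite addr_gt0.
have min0 : 0 < Num.min r3 (r - `|y1 - x|) by rewrite lt_min r30 subr_gt0.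
have s10 : 0 < s1 by rewrite divr_gt0.
have s1v0 : `|s1 *: v0| < Num.min r3 (r - `|y1 - x|).
  rewrite normrZ gtr0_norm// /s1 -mulrA gtr_pMr// mulrC ltr_pdivrMr// mul1r.
  by rewrite ltrDl.
move: s1v0; rewrite lt_min => /andP[s1r3 s1r].
have up : s1 * (dotv v0 v0 / 2) <= f (y1 + s1 *: v0) - f y1.
  apply: segment_increment_ge => t v /andP[t0 t1] Dv.
  rewrite dotvZl ler_pM2l//; apply: v0half Dv.
  rewrite addrAC subrr add0r (le_lt_trans _ s1r3)// normrZ.
  by rewrite ler_piMl// gtr0_norm// ltW.
have r1r : r <= r1 by rewrite ge_min lexx.
have down : f (y1 + s1 *: v0) - f y1 <= L * (s1 * `|v0|).
  rewrite (le_trans (ler_norm _))// (le_trans (fL _ _ _ _))//.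
  - rewrite addrAC (lt_le_trans _ r1r)// (le_lt_trans (ler_normD _ _))//.
    by rewrite -ltrBrDl.
  - exact: lt_le_trans y1x r1r.
  - by rewrite addrAC subrr add0r normrZ (gtr0_norm s10).
have := le_trans up down; rewrite [L * _]mulrCA ler_pM2l// leNgt => /negP; apply.
have rL : 2 * L < `|v0|.
  by apply: lt_trans v0rho; rewrite lt_max ltrDl ltr01 orbT.
rewrite ltr_pdivlMr// (lt_le_trans _ (normr_sqr_le_dotvv v0))//.
by rewrite -mulrA (mulrC `|v0|) mulrA expr2 ltr_pM2r// mulrC.
Qed.

End LocalBoundedness.

(** * Descent along solutions of the differential inclusion *)

Section DescentAlongCurves.
Context {R : realType} {n : nat}.
Variables (f : 'rV[R]_n -> R) (D : 'rV[R]_n -> set 'rV[R]_n) (sigma : R).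
Hypothesis Dcompact : forall x, compact (D x).
Hypothesis fpot : potential f D.
Notation mu := (@lebesgue_measure R).

Lemma regularizedE x : regularized sigma f x = f x + sigma / 2 * dotv x x.
Proof. by rewrite /regularized /enorm sqr_sqrtr ?dotvv_ge0. Qed.

(** The derivative from the right is tested along the increments [1 / m] only:
    this is what the limits of discrete trajectories give, for countably many
    window lengths of the noise. *)
Definition right_slope (gamma : R -> 'rV[R]_n) (t : R) (u : 'rV[R]_n) :=
  m.+1%:R *: (gamma (t + m.+1%:R^-1) - gamma t) @[m --> \oo] --> u.

(** Run the solution backwards, along [c s = gamma (T - T s)]. At almost every
    [s] the velocity [w = c' s] satisfies [w / T - sigma c = v0] for an element
    [v0] of [D (c s)], and the maximum in the chain rule is at least
    [dotv w v0 = |w|^2 / T - sigma (w . c)]. The last term is the derivative of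
    [- sigma / 2 |c|^2], which turns [f] into the regularized function. Time is reversed because a minorant of the maximum bounds increments of [f]
    from below. *)
Lemma lipschitz_descent (gamma : R -> 'rV[R]_n) (L B T eps : R) :
  (forall s t, `|gamma t - gamma s| <= L * `|t - s|) ->
  (forall t, `|gamma t| <= B) ->
  (forall t u, 0 <= t -> right_slope gamma t u ->
     regularized_field sigma D (gamma t) (- u)) ->
  0 < T -> 0 <= eps ->
  (forall t v, 0 <= t <= T -> regularized_field sigma D (gamma t) v ->
     eps <= `|v|) ->
  T * eps ^+ 2 <= regularized sigma f (gamma 0) - regularized sigma f (gamma T).
Proof.
move=> glip gB gDI T0 eps0 geps.
pose c (s : R) := gamma (T - T * s).
have clip (s t : R) : `|c t - c s| <= L * T * `|t - s|.
  rewrite (le_trans (glip _ _))//.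
  rewrite opprB addrC addrA subrK -mulrBr normrM (gtr0_norm T0) mulrA.
  by rewrite (distrC s).
have cB t : `|c t| <= B by exact: gB.
have B0 : 0 <= B by rewrite (le_trans _ (cB 0)).
have LT0 : 0 <= L * T.
  by have := clip 0 1; rewrite subr0 normr1 mulr1; exact: le_trans.
(* Both [|c|^2] and the coordinates of [c] are primitives of their
   derivatives. *)
pose phi (t : R) := dotv (c t) (c t).
have philip (s t : R) : `|phi t - phi s| <= n%:R * (L * T * (2 * B)) * `|t - s|.
  rewrite /phi.
  have -> : dotv (c t) (c t) - dotv (c s) (c s) = dotv (c t - c s) (c t + c s).
    rewrite dotvBl !dotvDr (dotvC (c s) (c t)); lra.
  rewrite (le_trans (normr_dotv_le _ _))// -mulrA ler_wpM2l//.
  rewrite [leRHS]mulrAC ler_pM// (le_trans (ler_normD _ _))//.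
  by rewrite mulr_natl lerD.
have [p [pint pder pval]] := lipschitz_primitive philip.
have cilip i (s t : R) : `|c t 0 i - c s 0 i| <= L * T * `|t - s|.
  apply: le_trans (clip s t); have := normr_coord_le (c t - c s) i.
  by rewrite !mxE.
have /choice[u uP] : forall i, exists u : R -> R,
    {ae mu, forall t : R, 0 < t < 1 -> is_derive t 1 (fun s => c s 0 i) (u t)}.
  by move=> i; have [u [_ ? _]] := lipschitz_primitive (cilip i); exists u.
have uae : {ae mu, forall t : R, forall i, 0 < t < 1 ->
    is_derive t 1 (fun s => c s 0 i) (u i t)}.
  exact: (@filter_forall _ _ _ _ (ae_filter_ringOfSetsType mu) uP).
pose h (t : R) : R := T * eps ^+ 2 - sigma / 2 * p t.
have mI : measurable (`[0, 1]%classic : set (measurableTypeR R)).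
  exact: measurable_itv.
have cint := integrable_cst_itv01 (T * eps ^+ 2).
have pZint : mu.-integrable `[0, 1] (fun t : R => ((sigma / 2)%R%:E * (p t)%:E)%E).
  have pZ := integrableZl mI (sigma / 2) pint; exact: pZ.
have hint : mu.-integrable `[0, 1] (EFin \o h).
  rewrite (_ : _ \o _ = ((EFin \o cst (T * eps ^+ 2)%R) \-
                         (fun t => (sigma / 2)%R%:E * (p t)%:E))%E); last first.
    by apply/funext => t; rewrite /h /= EFinB EFinM.
  have hI := integrableB mI cint pZint; exact: hI.
have hval : (\int[mu]_(t in `[0%R, 1%R]) (h t)%:E =
    (T * eps ^+ 2 - sigma / 2 * (phi 1 - phi 0))%:E)%E.
  rewrite /h; under eq_integral do rewrite EFinB EFinM.
  have iB := integralB mI cint pZint; rewrite [LHS]iB.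
  have iZ := integralZl mI pint (sigma / 2); rewrite [X in (_ - X)%E]iZ.
  rewrite pval /= integral_cst//.
  have mu01 : mu `[(0 : R), 1]%classic = 1%E.
    by rewrite lebesgue_measure_itv/= lte_fin ltr01 oppr0 adde0.
  by rewrite [X in (_ * X)%E]mu01 mule1 [RHS]EFinB [in RHS]EFinM.
have := @potential_increment_ge R n f D c h _ fpot (lipschitz_abs_continuous clip)
  hint _ hval.
rewrite /phi /c mulr0 mulr1 subr0 subrr !regularizedE.
suff: {ae mu, forall t : R, 0 < t < 1 -> h t <= max_dot D (c t) (derive1 c t)}.
  move=> hle /(_ hle); lra.
move: pder uae; apply: (@filterS2 _ _ (ae_filter_ringOfSetsType mu)) => t pt ut t01.
pose w : 'rV[R]_n := \row_i u i t.
have cw : is_derive t 1 c w.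
  have dc : derivable c t 1.
    by apply/derivable_mxP => i j; rewrite ord1; case: (ut j t01).
  apply: DeriveDef => //; rewrite derive_mx//; apply/rowP => j; rewrite !mxE.
  by case: (ut j t01).
have p2 : p t = 2 * dotv w (c t).
  have h1 : is_derive t 1 phi (p t) := pt t01.
  have h2 : is_derive t 1 phi (\sum_i (c t 0 i *: u i t + c t 0 i *: u i t)).
    have -> : phi = \sum_i ((fun s => c s 0 i) * (fun s => c s 0 i)).
      by apply/funext => s; rewrite fct_sumE.
    by apply: is_derive_sum => i; apply: is_deriveM; exact: ut.
  rewrite -(@derive_val _ _ _ _ _ _ _ h1) (@derive_val _ _ _ _ _ _ _ h2).
  rewrite /dotv mulr_sumr; apply: eq_bigr => i _; rewrite !mxE /GRing.scale /=; ring.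
have slope : right_slope gamma (T - T * t) (- (T^-1 *: w)).
  have dc : (s^-1 *: (c (s + t) - c t)) @[s --> 0^'] --> w.
    have [dct <-] := cw.
    have -> : (fun s => s^-1 *: (c (s + t) - c t)) =
        (fun s => s^-1 *: ((c \o shift t) (s *: (1 : R)) - c t)).
      by apply/funext => s; rewrite /= [_%:A]mulr1.
    exact: dct.
  pose s_ (m : nat) : R := - (m.+1%:R * T)^-1.
  have s0 m : s_ m != 0 by rewrite oppr_eq0 invr_eq0 mulf_neq0 ?gt_eqF// ltr0n.
  have scvg : s_ m @[m --> \oo] --> 0^'.
    have sc : s_ m @[m --> \oo] --> 0.
      have -> : s_ = (fun m => - T^-1 * harmonic m).
        by apply/funext => m; rewrite /s_ /harmonic invfM mulNr mulrC.
      rewrite -(mulr0 (- T^-1)); apply: cvgM; first exact: cvg_cst.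
      exact: cvg_harmonic.
    move=> P nP; suff: \forall m \near \oo, P (s_ m) by [].
    have nsP : \forall m \near \oo, s_ m != 0 -> P (s_ m) := sc _ nP.
    by apply: filterS nsP => m; apply.
  pose F1 (m : nat) : 'rV[R]_n :=
    m.+1%:R *: (gamma (T - T * t + m.+1%:R^-1) - gamma (T - T * t)).
  pose F2 (m : nat) : 'rV[R]_n := - T^-1 *: ((s_ m)^-1 *: (c (s_ m + t) - c t)).
  have F21 : F2 = F1.
    have T1 : T != 0 by rewrite gt_eqF.
    apply/funext => m; have k0 : (m.+1%:R : R) != 0 by rewrite pnatr_eq0.
    rewrite /F1 /F2 scalerA /c /s_; move: (m.+1%:R) k0 => k k0.
    by congr (_ *: (gamma _ - _)); field; rewrite k0 T1.
  have F2w : F2 @ \oo --> - T^-1 *: w.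
    exact: (cvgZ (cvg_cst (- T^-1)) (cvg_comp _ _ scvg dc)).
  by rewrite F21 scaleNr in F2w; exact: F2w.
have t0' : 0 <= T - T * t.
  by case/andP: t01 => t0 t1; rewrite subr_ge0 ger_pMr// ltW.
have := gDI _ _ t0' slope; rewrite opprK -/(c t) => -[v0 Dv0 v0E].
rewrite derive1E (@derive_val _ _ _ _ _ _ _ cw).
apply: le_trans (dotv_le_max_dot w (@Dcompact _) Dv0).
have -> : v0 = T^-1 *: w - sigma *: c t by rewrite -v0E addrK.
rewrite dotvBr !dotvZr /h p2.
have : eps <= `|T^-1 *: w|.
  apply: (geps (T - T * t)); last by exists v0.
  by rewrite t0' gerBl mulr_ge0 ?ltW//; case/andP: t01.
rewrite normrZ gtr0_norm ?invr_gt0// ler_pdivlMl// => epsw.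
have : (T * eps) ^+ 2 <= dotv w w.
  by rewrite (le_trans _ (normr_sqr_le_dotvv w))// ler_sqr ?nnegrE ?mulr_ge0// ltW.
rewrite -(ler_pM2l (_ : 0 < T^-1)) ?invr_gt0//.
have -> : T^-1 * (T * eps) ^+ 2 = T * eps ^+ 2 by field; rewrite gt_eqF.
lra.
Qed.

End DescentAlongCurves.

(** * Limit curves of discrete trajectories *)

(** Limits along an ultrafilter replace the extraction of a subsequence that
    converges at all times. *)
Lemma ultra_compact_cvg (R : realType) (n : nat) T (U : set_system T)
    {UU : UltraFilter U} (h : T -> 'rV[R]_n) (B : R) :
  (forall j, `|h j| <= B) -> exists x, `|x| <= B /\ h @ U --> x.
Proof.
move=> hB; have := @closed_ball0_compact R n B (h @ U) _ _.
case; first by apply: nearW => j; exact: hB.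
move=> x [xB clx]; exists x; split => // V nV.
have [//|nVc] := in_ultra_setVsetC (h @^-1` V) UU.
have [z [/= zV Vz]] := clx (~` V) V nVc nV.
by exfalso; exact: zV.
Qed.

(** The step sizes [a] define a time scale: step [k] takes place at time
    [clock k], and [tick tau] is the first step that is not before time
    [tau]. *)
Section TimeChange.
Context {R : realType}.
Variable a : nat -> R.
Hypothesis a_gt0 : forall k, 0 < a k.
Hypothesis a_cvg0 : a @ \oo --> 0.
Hypothesis a_div : forall c : R, exists n, c <= \sum_(i < n) a i.

Definition clock (n : nat) : R := \sum_(i < n) a i.

Lemma clockS n : clock n.+1 = clock n + a n.
Proof. by rewrite /clock big_ord_recr. Qed.

Lemma clock_lt m n : (m < n)%N -> clock m < clock n.
Proof.
elim: n => // n IH; rewrite ltnS leq_eqVlt clockS => /orP[/eqP->|/IH mn].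
  by rewrite ltrDl.
by rewrite (lt_trans mn)// ltrDl.
Qed.

Lemma clock_le m n : (m <= n)%N -> clock m <= clock n.
Proof. by rewrite leq_eqVlt => /orP[/eqP->//|/clock_lt/ltW]. Qed.

Lemma clock_le_inv m n : clock m <= clock n -> (m <= n)%N.
Proof. by move=> mn; rewrite leqNgt; apply/negP => /clock_lt; rewrite ltNge mn. Qed.

Definition tick (tau : R) : nat := ex_minn (a_div tau).

Lemma clock_tick_ge tau : tau <= clock (tick tau).
Proof. by rewrite /tick; case: ex_minnP. Qed.

Lemma clock_lt_tick tau n : (n < tick tau)%N -> clock n < tau.
Proof.
rewrite /tick; case: ex_minnP => m _ mmin nm.
by rewrite ltNge; apply/negP => /mmin; rewrite leqNgt nm.
Qed.

Lemma le_tick k tau : clock k <= tau -> (k <= tick tau)%N.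
Proof. by move=> ktau; apply: clock_le_inv; rewrite (le_trans ktau)// clock_tick_ge. Qed.

Lemma tick_clock k : tick (clock k) = k.
Proof.
apply/eqP; rewrite eqn_leq le_tick// andbT /tick.
by case: ex_minnP => m _; apply.
Qed.

Lemma clock_tick_le k tau c : 0 <= c -> (forall i, (k <= i)%N -> a i <= c) ->
  clock k <= tau -> clock (tick tau) <= tau + c.
Proof.
move=> c0 ac ktau; have := le_tick ktau.
rewrite leq_eqVlt => /orP[/eqP <-|]; first by rewrite (le_trans ktau)// lerDl.
case: (tick tau) (@clock_lt_tick tau) => // j jtau; rewrite ltnS => kj.
by rewrite clockS lerD ?ac// ltW// jtau.
Qed.

Lemma cvg_window T (F : set_system T) {FF : Filter F} (k_ : T -> nat) (t : R) :
  0 <= t -> k_ @ F --> \oo ->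
  clock (tick (clock (k_ j) + t)) - clock (k_ j) @[j --> F] --> t.
Proof.
move=> t0 kF; apply/cvgrPdist_le => e e0.
have [N _ aN] := (cvgr0Pnorm_le _).1 a_cvg0 e e0.
have : \forall j \near F, (N <= k_ j)%N := kF _ (nbhs_infty_ge N).
apply: filterS => j Nj.
have kt : clock (k_ j) <= clock (k_ j) + t by rewrite lerDl.
have := @clock_tick_le (k_ j) (clock (k_ j) + t) e (ltW e0) _ kt.
have := clock_tick_ge (clock (k_ j) + t).
move=> lo /(_ _) hi.
have {}hi := hi (fun i ki => le_trans (ler_norm _) (aN i (leq_trans Nj ki))).
rewrite ler_norml; apply/andP; split; lra.
Qed.

Lemma cvg_tick_infty T (F : set_system T) {FF : Filter F} (k_ : T -> nat) (t : R) :
  0 <= t -> k_ @ F --> \oo -> tick (clock (k_ j) + t) @[j --> F] --> \oo.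
Proof.
move=> t0 kF A [N _ NA].
have : \forall j \near F, (N <= k_ j)%N := kF _ (nbhs_infty_ge N).
apply: filterS => j Nj; apply: NA => /=.
by rewrite (leq_trans Nj)// le_tick// lerDl.
Qed.

Section Trajectory.
Context {n : nat}.
Variables (y w xi : nat -> 'rV[R]_n) (L B : R).
Hypothesis ystep : forall k, y k.+1 = y k - a k *: (w k + xi k).
Hypothesis yB : forall k, `|y k| <= B.
Hypothesis wL : forall k, `|w k + xi k| <= L.

Lemma trajectory_windowE p q : (p <= q)%N ->
  y q - y p = - \sum_(p <= i < q) a i *: (w i + xi i).
Proof.
elim: q => [|q IH]; first by rewrite leqn0 => /eqP ->; rewrite big_geq// subrr oppr0.
rewrite leq_eqVlt => /orP[/eqP <-|]; first by rewrite big_geq// subrr oppr0.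
rewrite ltnS => pq; rewrite big_nat_recr//= ystep opprD -IH//.
by rewrite addrAC.
Qed.

Lemma clock_windowE p q : (p <= q)%N ->
  clock q - clock p = \sum_(p <= i < q) a i.
Proof.
move=> pq; rewrite /clock -!(big_mkord xpredT a) [X in X - _](big_cat_nat _ pq)//=.
by rewrite addrAC subrr add0r.
Qed.

Lemma trajectory_lipschitz p q : `|y q - y p| <= L * `|clock q - clock p|.
Proof.
wlog pq : p q / (p <= q)%N.
  move=> h; have [/h//|/ltnW /h] := leqP p q.
  by rewrite distrC (distrC (clock p)).
rewrite trajectory_windowE// normrN clock_windowE//.
rewrite [X in _ <= _ * X]ger0_norm; last by apply: sumr_ge0 => i _; exact: ltW.
rewrite mulr_sumr (le_trans (ler_norm_sum _ _ _))// ler_sum// => i _.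
by rewrite normrZ gtr0_norm// mulrC ler_wpM2r// ltW.
Qed.

(** The pointwise limit inherits the Lipschitz constant, since the trajectory is
    [L]-Lipschitz in the time scale and windows of prescribed length have
    asymptotically that length. *)
Lemma limit_curve (U : set_system nat) {UU : UltraFilter U} (k_ : nat -> nat) :
  k_ @ U --> \oo ->
  exists gamma : R -> 'rV[R]_n,
  [/\ forall t, `|gamma t| <= B,
      forall s t, `|gamma t - gamma s| <= L * `|t - s| &
      forall t, 0 <= t -> y (tick (clock (k_ j) + t)) @[j --> U] --> gamma t].
Proof.
move=> kU; pose Y t j := y (tick (clock (k_ j) + Num.max t 0)).
have : forall t, exists x, `|x| <= B /\ Y t @ U --> x.
  by move=> t; apply: ultra_compact_cvg => j; exact: yB.
move=> /choice[gamma gammaP]; exists gamma; split.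
- by move=> t; case: (gammaP t).
- move=> s t.
  have cYs := (gammaP s).2; have cYt := (gammaP t).2.
  have lhs : `|Y t j - Y s j| @[j --> U] --> `|gamma t - gamma s|.
    exact: (cvg_norm (cvgB cYt cYs)).
  have rhs : L * `|clock (tick (clock (k_ j) + Num.max t 0)) - clock (k_ j) -
               (clock (tick (clock (k_ j) + Num.max s 0)) - clock (k_ j))|
       @[j --> U] --> L * `|Num.max t 0 - Num.max s 0|.
    apply: cvgM; first exact: cvg_cst.
    by apply: cvg_norm; apply: cvgB; apply: cvg_window; rewrite // le_max lexx orbT.
  apply: (le_trans (y := L * `|Num.max t 0 - Num.max s 0|)).
    apply: (ler_cvg_to lhs rhs); apply: nearW => j.
    rewrite (le_trans (trajectory_lipschitz _ _))//.
    by rewrite opprB addrA subrK.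
  rewrite ler_wpM2l//; first by rewrite (le_trans _ (wL 0)).
  have [t0|t0] := leP t 0; have [s0|s0] := leP s 0.
  + by rewrite subrr normr0.
  + by rewrite sub0r normrN gtr0_norm// ler0_norm; lra.
  + by rewrite subr0 gtr0_norm// gtr0_norm; lra.
  + by [].
- by move=> t t0; have [_] := gammaP t; rewrite /Y (max_l t0).
Qed.

Variable G : 'rV[R]_n -> set 'rV[R]_n.
Hypothesis Gneq0 : forall x, G x !=set0.
Hypothesis Gcompact : forall x, compact (G x).
Hypothesis Gconvex : forall x, @convex_set R 'rV[R]_n (G x).
Hypothesis wG : forall (x : 'rV[R]_n) (e : R), 0 < e -> exists2 r : R, 0 < r &
  exists N : nat, forall k, (N <= k)%N -> `|y k - x| < r ->
    exists2 v, G x v & `|w k - v| < e.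
Hypothesis noise : forall m : nat,
  \sum_(k <= i < tick (clock k + m.+1%:R^-1)) a i *: xi i @[k --> \oo] --> (0 : 'rV[R]_n).

(** If [- u] were not in [G (gamma t)], a hyperplane with normal [q] would
    separate them. For late [k] with [y k] near [gamma t], the direction [w k] is
    close to [G (gamma t)], so [- dotv q (w k) >= beta] with [beta > dotv q u].
    Over a short window of length [h] after time [t] all [y k] stay near
    [gamma t], and the noise vanishes in the limit; summing gives
    [dotv q (gamma (t + h) - gamma t) >= beta h]. Dividing by [h] contradicts the
    choice of [beta]. *)
Lemma limit_curve_inclusion (U : set_system nat) {UU : UltraFilter U}
    (k_ : nat -> nat) (gamma : R -> 'rV[R]_n) :
  k_ @ U --> \oo ->
  (forall t, 0 <= t -> y (tick (clock (k_ j) + t)) @[j --> U] --> gamma t) ->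
  forall t u, 0 <= t -> right_slope gamma t u -> G (gamma t) (- u).
Proof.
move=> kU Ygamma t u t0 slope; apply: contrapT => Gu.
have FU : Filter U by typeclasses eauto.
have [v0 Gv0 [q0]] := convex_compact_separation (Gneq0 _) (@Gcompact _) (@Gconvex _) Gu.
have [q qE] : exists q, q = - u - v0 by exists (- u - v0).
rewrite -qE in q0 *; move=> qsep.
have qq : 0 < dotv q q by rewrite lt_neqAle dotvv_ge0 andbT eq_sym dotvv_eq0.
have C0 : 0 < n%:R * `|q| + 1 by rewrite ltr_wpDl// mulr_ge0.
pose e := dotv q q / 2 / (n%:R * `|q| + 1).
have e0 : 0 < e by rewrite !divr_gt0.
have [r r0 [N wN]] := wG (gamma t) e0.
pose beta := dotv q u + dotv q q / 2.
have qw k : (N <= k)%N -> `|y k - gamma t| < r -> beta <= - dotv q (w k).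
  move=> Nk yk; have [v Gv wv] := wN k Nk yk.
  have := qsep v Gv; rewrite dotvNr => qv.
  have : `|dotv q (w k - v)| <= dotv q q / 2.
    rewrite (le_trans (normr_dotv_le _ _))//.
    apply: (@le_trans _ _ ((n%:R * `|q| + 1) * e)).
      by rewrite mulrA ler_pM ?mulr_ge0// ?lerDl// ltW.
    by rewrite /e mulrC divfK// gt_eqF.
  rewrite dotvBr ler_norml => /andP[] _; rewrite /beta; lra.
have key (m : nat) : L * m.+1%:R^-1 < r / 2 ->
    beta * m.+1%:R^-1 <= dotv q (gamma (t + m.+1%:R^-1) - gamma t).
  set h := m.+1%:R^-1 => Lh.
  have h0 : 0 < h by rewrite invr_gt0.
  pose p j := tick (clock (k_ j) + t).
  pose p' j := tick (clock (p j) + h).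
  have pU : p @ U --> \oo by exact: cvg_tick_infty.
  have yp : y (p j) @[j --> U] --> gamma t by exact: Ygamma.
  have th0 : 0 <= t + h by rewrite addr_ge0// ltW.
  have yth := Ygamma _ th0.
  have win : clock (p' j) - clock (p j) @[j --> U] --> h.
    exact: (cvg_window (ltW h0) pU).
  (* [p'] is counted from step [p], whereas the curve at time [t + h] is counted
     from [k_ j]; both steps take place at asymptotically the same time. *)
  have yp' : y (p' j) @[j --> U] --> gamma (t + h).
    pose c j := clock (p' j) - clock (tick (clock (k_ j) + (t + h))).
    have c0 : L * `|c j| @[j --> U] --> 0.
      have -> : c = fun j => (clock (p' j) - clock (p j)) + (clock (p j) - clock (k_ j))
          - (clock (tick (clock (k_ j) + (t + h))) - clock (k_ j)).
        apply/funext => j; rewrite /c; ring.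
      have : 0 = L * `|h + t - (t + h)| by rewrite (addrC h) subrr normr0 mulr0.
      move=> ->; apply: cvgM; first exact: cvg_cst.
      apply: cvg_norm; apply: cvgB; last exact: (cvg_window th0 kU).
      by apply: cvgD; [exact: win|exact: (cvg_window t0 kU)].
    have d0 : y (p' j) - y (tick (clock (k_ j) + (t + h))) @[j --> U] --> (0 : 'rV[R]_n).
      apply/cvgr0Pnorm_le => d d0.
      have nd : \forall j \near U, `|L * `|c j| | <= d :=
        (cvgr0Pnorm_le (FF := FU) _).1 c0 d d0.
      apply: (@filterS _ U _ _ _ _ nd) => j.
      apply: le_trans; rewrite (le_trans (trajectory_lipschitz _ _))//.
      exact: ler_norm.
    have : (fun j => (y (p' j) - y (tick (clock (k_ j) + (t + h)))) +
        y (tick (clock (k_ j) + (t + h)))) @ U --> 0 + gamma (t + h) by exact: cvgD.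
    rewrite add0r; apply: cvg_trans.
    rewrite (_ : (fun j => _ + _) = (fun j => y (p' j)))//.
    by apply/funext => j; rewrite subrK.
  have lhs : beta * (clock (p' j) - clock (p j))
      - dotv q (\sum_(p j <= i < p' j) a i *: xi i) @[j --> U] --> beta * h - dotv q 0.
    apply: cvgB; first by apply: cvgM; [exact: cvg_cst|exact: win].
    apply: cvg_dotv; first exact: cvg_cst.
    exact: (cvg_comp _ _ pU (noise m)).
  have rhs : dotv q (y (p' j) - y (p j)) @[j --> U] --> dotv q (gamma (t + h) - gamma t).
    by apply: cvg_dotv; [exact: cvg_cst|exact: cvgB].
  move: lhs; rewrite dotv0r subr0 => lhs; apply: (ler_cvg_to lhs rhs).
  have pN : \forall j \near U, (N <= p j)%N := pU _ (nbhs_infty_ge N).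
  have ypr : \forall j \near U, `|gamma t - y (p j)| < r / 2.
    by apply: ((cvgrPdist_lt (FF := FU) _ _).1 yp); rewrite divr_gt0.
  apply: (@filterS2 _ U _ _ _ _ _ pN ypr) => j Np yj.
  have pp' : (p j <= p' j)%N by rewrite le_tick// lerDl ltW.
  rewrite trajectory_windowE// dotvNr.
  have -> : \sum_(p j <= i < p' j) a i *: (w i + xi i) =
      \sum_(p j <= i < p' j) a i *: w i + \sum_(p j <= i < p' j) a i *: xi i.
    by rewrite -big_split; apply: eq_bigr => i _; rewrite scalerDr.
  rewrite dotvDr opprD lerB// dotv_sumr clock_windowE// mulr_sumr -sumrN.
  rewrite big_nat_cond [leRHS]big_nat_cond ler_sum// => i /andP[/andP[pi ip'] _].
  rewrite dotvZr -mulrN mulrC ler_wpM2l ?(ltW (a_gt0 _))//.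
  apply: qw; first exact: leq_trans Np pi.
  have -> : y i - gamma t = (y i - y (p j)) - (gamma t - y (p j)) by rewrite opprB addrA subrK.
  rewrite (le_lt_trans (ler_normB _ _))// (splitr r) ltr_leD//; last exact: ltW.
  rewrite (le_lt_trans (trajectory_lipschitz _ _))// (le_lt_trans _ Lh)//.
  have L0 : 0 <= L by rewrite (le_trans _ (wL 0)).
  rewrite ler_wpM2l// ger0_norm ?subr_ge0 ?clock_le//.
  by rewrite lerBlDl ltW// clock_lt_tick.
have lim1 : dotv q (m.+1%:R *: (gamma (t + m.+1%:R^-1) - gamma t)) @[m --> \oo] --> dotv q u.
  exact: (cvg_dotv (cvg_cst q) slope).
have Lm : L * m.+1%:R^-1 @[m --> \oo] --> 0.
  by rewrite -(mulr0 L); apply: cvgM; [exact: cvg_cst|exact: cvg_harmonic].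
have nearLm : \forall m \near \oo, L * m.+1%:R^-1 < r / 2.
  have r20 : 0 < r / 2 by rewrite divr_gt0.
  exact: (cvgr_lt _ Lm _ r20).
have : beta <= dotv q u.
  apply: (cvgr_to_ge lim1).
  apply: filterS nearLm => m /key; rewrite dotvZr /=.
  by rewrite -(ler_pM2l (_ : 0 < m.+1%:R :> R)) ?ltr0n// mulrCA mulfV ?mulr1// pnatr_eq0.
by rewrite /beta gerDl leNgt divr_gt0.
Qed.

End Trajectory.
End TimeChange.

(** * The regularized field *)

Section RegularizedField.
Context {R : realType} {n : nat}.
Variables (f : 'rV[R]_n -> R) (D : 'rV[R]_n -> set 'rV[R]_n) (sigma : R).
Hypothesis flip : locally_lipschitz f.
Hypothesis Dclosed : closed [set p : 'rV[R]_n * 'rV[R]_n | D p.1 p.2].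
Hypothesis Dneq0 : forall x, D x !=set0.
Hypothesis Dcompact : forall x, compact (D x).
Hypothesis Dconvex : forall x, @convex_set R 'rV[R]_n (D x).
Hypothesis fpot : potential f D.
Hypothesis sigma_gt0 : 0 < sigma.
Local Notation G := (regularized_field sigma D).
Local Notation g := (regularized sigma f).

Lemma regularized_field_neq0 x : G x !=set0.
Proof. by have [v Dv] := Dneq0 x; exists (v + sigma *: x); exists v. Qed.

Lemma regularized_field_compact x : compact (G x).
Proof.
apply: (@continuous_compact _ _ (fun v => v + sigma *: x) (D x)); last exact: Dcompact.
apply: continuous_subspaceT.
suff c (v : 'rV[R]_n) : v + sigma *: x @[v --> v] --> v + sigma *: x by exact: c.
exact: (@cvgD _ _ _ (nbhs v) _ id (cst (sigma *: x)) _ _ (cvg_id (F := nbhs v)) (cvg_cst _)).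
Qed.

Lemma regularized_field_convex x : @convex_set R 'rV[R]_n (G x).
Proof.
move=> u v l /set_mem[u' Du' uE] /set_mem[v' Dv' vE].
apply/mem_set; exists (conv l (u' : convex_lmodType 'rV[R]_n) v').
  by apply/set_mem; apply: Dconvex; exact/mem_set.
rewrite -uE -vE /conv /=. rewrite !scalerDr addrACA -scalerDl.
by rewrite (_ : _ + unstable.onem _ = 1) ?scale1r// /unstable.onem addrC subrK.
Qed.

Lemma field_usc x e : 0 < e ->
  exists2 r, 0 < r & forall y, `|y - x| < r -> forall v, D y v ->
    exists2 w, D x w & `|v - w| < e.
Proof.
apply: (locally_bounded_usc Dclosed).
exact: conservative_locally_bounded flip Dclosed Dneq0 Dcompact Dconvex fpot x.
Qed.

Lemma field_bounded (M : R) : exists C : R, forall x, `|x| <= M ->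
  forall v, D x v -> `|v| <= C.
Proof.
have := (compact_near_coveringP _).1 (@closed_ball0_compact R n M) R (+oo)
  (fun C x => forall v, D x v -> `|v| <= C) _.
case => [x _|C0 [_ C0P]]; last first.
  by exists (C0 + 1) => x xM; apply: (C0P (C0 + 1)) => //; rewrite ltrDl.
have [rho rho0 [r r0 xr]] :=
  conservative_locally_bounded flip Dclosed Dneq0 Dcompact Dconvex fpot x.
exists ([set y | `|y - x| < r], [set C : R | rho < C]).
  split; first by apply/nbhs_rVP; exists r.
  by exists rho; split => //; exact: num_real.
move=> [y C] /= [yr rC] v Dv.
by rewrite (le_trans (xr y yr v Dv))// ltW.
Qed.

(** The value at [z] is compact and does not contain [0]; semicontinuity carries
    the gap over to neighbouring points. *)
Lemma regularized_field_away z : ~ G z 0 -> exists2 e, 0 < e &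
  exists2 r, 0 < r & forall x, `|x - z| < r -> forall v, G x v -> e <= `|v|.
Proof.
move=> Gz0.
have cG : closed (G z).
  by apply: compact_closed; [exact: norm_hausdorff|exact: regularized_field_compact].
have /nbhs_rVP[e1 e10 eG] : nbhs (0 : 'rV[R]_n) (~` G z).
  by apply: open_nbhs_nbhs; split => //; exact: closed_openC.
have {}eG v : G z v -> e1 <= `|v|.
  move=> Gv; rewrite leNgt; apply/negP => ve.
  by apply: (eG v) => //; rewrite subr0.
have e40 : 0 < e1 / 4 by rewrite divr_gt0.
have [r r0 zr] := field_usc z e40.
exists (e1 / 2); first by rewrite divr_gt0.
have r'0 : 0 < e1 / 4 / sigma by rewrite divr_gt0.
exists (Num.min r (e1 / 4 / sigma)); first by rewrite lt_min r0.
move=> x; rewrite lt_min => /andP[xr xs] _ [v Dv <-].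
have [w Dw vw] := zr x xr v Dv.
have := eG (w + sigma *: z) (ex_intro2 _ _ w Dw erefl).
have -> : w + sigma *: z = (v + sigma *: x) - ((v - w) + sigma *: (x - z)).
  by rewrite scalerBr; apply/rowP => i; rewrite !mxE; ring.
move=> h; have := le_trans h (ler_normB _ _).
have := ler_normD (v - w) (sigma *: (x - z)).
have : `|sigma *: (x - z)| < e1 / 4.
  by rewrite normrZ gtr0_norm// mulrC -ltr_pdivlMr.
lra.
Qed.

Lemma regularized_continuous x e : 0 < e -> exists2 r, 0 < r &
  forall y, `|y - x| < r -> `|g y - g x| < e.
Proof.
move=> e0; have [L L0 [r r0 fL]] := locally_lipschitz_ball x flip.
pose C := L + sigma / 2 * (n%:R * (2 * `|x| + 1)).
have s20 : 0 <= sigma / 2 by rewrite divr_ge0// ltW.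
have C0 : 0 <= C by rewrite addr_ge0// mulr_ge0// mulr_ge0// addr_ge0// mulr_ge0.
have C1 : 0 < C + 1 by rewrite ltr_wpDl.
exists (Num.min r (Num.min 1 (e / (C + 1)))).
  by rewrite !lt_min r0 ltr01 divr_gt0.
move=> y; rewrite !lt_min => /and3P[yr y1 ye].
rewrite !regularizedE.
have -> : f y + sigma / 2 * dotv y y - (f x + sigma / 2 * dotv x x) =
    (f y - f x) + sigma / 2 * dotv (y - x) (y + x).
  by rewrite dotvBl !dotvDr (dotvC x y); ring.
have xr : `|x - x| < r by rewrite subrr normr0.
have fyx := fL y x yr xr.
have dyx : `|sigma / 2 * dotv (y - x) (y + x)| <=
    sigma / 2 * (n%:R * (2 * `|x| + 1)) * `|y - x|.
  rewrite normrM (ger0_norm s20) -[leRHS]mulrA ler_wpM2l// -mulrA.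
  rewrite (le_trans (normr_dotv_le _ _))// ler_wpM2l// mulrC ler_wpM2r//.
  have -> : y + x = (y - x) + (x + x) by rewrite addrA subrK.
  rewrite (le_trans (ler_normD _ _))// [leRHS]addrC lerD//; first exact: ltW.
  by rewrite (le_trans (ler_normD _ _))// mulr_natl.
rewrite (le_lt_trans (ler_normD _ _))//.
apply: (@le_lt_trans _ _ (C * `|y - x|)); first by rewrite mulrDl lerD.
rewrite (@le_lt_trans _ _ ((C + 1) * `|y - x|))//.
  by rewrite ler_wpM2r// lerDl.
by rewrite mulrC -ltr_pdivlMr.
Qed.

End RegularizedField.

(** * Convergence of the values along a perturbed trajectory *)

Section DescentSequence.
Context {R : realType} {n : nat}.
Variables (f : 'rV[R]_n -> R) (D : 'rV[R]_n -> set 'rV[R]_n) (sigma : R).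
Hypothesis flip : locally_lipschitz f.
Hypothesis Dclosed : closed [set p : 'rV[R]_n * 'rV[R]_n | D p.1 p.2].
Hypothesis Dneq0 : forall x, D x !=set0.
Hypothesis Dcompact : forall x, compact (D x).
Hypothesis Dconvex : forall x, @convex_set R 'rV[R]_n (D x).
Hypothesis fpot : potential f D.
Hypothesis sigma_gt0 : 0 < sigma.
Local Notation G := (regularized_field sigma D).
Local Notation g := (regularized sigma f).

Variable a : nat -> R.
Hypothesis a_gt0 : forall k, 0 < a k.
Hypothesis a_cvg0 : a @ \oo --> 0.
Hypothesis a_div : forall c : R, exists n, c <= \sum_(i < n) a i.
Local Notation clock := (clock a).
Local Notation tick := (tick a_div).

Variables (y w xi : nat -> 'rV[R]_n) (L B : R).
Hypothesis ystep : forall k, y k.+1 = y k - a k *: (w k + xi k).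
Hypothesis yB : forall k, `|y k| <= B.
Hypothesis wL : forall k, `|w k + xi k| <= L.
Hypothesis wG : forall (x : 'rV[R]_n) (e : R), 0 < e -> exists2 r : R, 0 < r &
  exists N : nat, forall k, (N <= k)%N -> `|y k - x| < r ->
    exists2 v, G x v & `|w k - v| < e.
Hypothesis noise : forall m : nat,
  \sum_(k <= i < tick (clock k + m.+1%:R^-1)) a i *: xi i @[k --> \oo] --> (0 : 'rV[R]_n).

(** The compactness argument. If it failed for some window length [T], there
    would be windows starting ever later and ever closer to [z] without the
    decrease; a limit curve of them starts at [z], stays where the field is at
    distance [e0] from [0] when [T] is small, and decreases the regularized
    function by [T e0^2], twice the required amount. *)
Lemma window_descent z : ~ G z 0 -> exists2 T1 : R, 0 < T1 & forall T, 0 < T <= T1 ->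
  exists2 eps : R, 0 < eps & exists2 r : R, 0 < r & exists N : nat, forall k,
    (N <= k)%N -> `|y k - z| < r -> g (y (tick (clock k + T))) <= g z - eps.
Proof.
move=> Gz0.
have [e0 e00 [r0 r00 zr]] := regularized_field_away flip Dclosed Dneq0 Dcompact Dconvex
  fpot sigma_gt0 Gz0.
have L0 : 0 <= L by rewrite (le_trans _ (wL 0)).
have L1 : 0 < L + 1 by rewrite ltr_wpDl.
exists (r0 / 2 / (L + 1)); first by rewrite !divr_gt0.
move=> T /andP[T0 TT1].
have LT : L * T < r0.
  apply: (@le_lt_trans _ _ (r0 / 2)); last by rewrite ltr_pdivrMr// ltr_pMr// ltr1n.
  move: TT1; rewrite ler_pdivlMr// mulrC; apply: le_trans.
  by rewrite ler_wpM2r ?(ltW T0)// lerDl.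
have Te0 : 0 < T * e0 ^+ 2 by rewrite mulr_gt0// exprn_gt0.
exists (T * e0 ^+ 2 / 2); first by rewrite divr_gt0.
apply: contrapT => nodesc.
have /choice[k_ kP] : forall j : nat, exists k, [/\ (j <= k)%N,
    `|y k - z| < j.+1%:R^-1 & g z - T * e0 ^+ 2 / 2 < g (y (tick (clock k + T)))].
  move=> j; apply: contrapT => nok; apply: nodesc.
  exists j.+1%:R^-1; first by rewrite invr_gt0.
  exists j => k jk yk; rewrite leNgt; apply/negP => gk.
  by apply: nok; exists k.
have [U [UU oU]] := ultraFilterLemma (eventually_filter).
have kU : k_ @ U --> \oo.
  move=> A [N _ NA]; apply: oU; exists N => // j Nj; apply: NA => /=.
  by rewrite (leq_trans Nj)//; case: (kP j).
have [gamma [gB glip Ygamma]] := limit_curve a_gt0 a_cvg0 a_div ystep yB wL kU.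
have gDI := limit_curve_inclusion a_gt0 a_cvg0 ystep wL
  (regularized_field_neq0 sigma Dneq0)
  (@regularized_field_compact R n D sigma Dcompact)
  (@regularized_field_convex R n D sigma Dconvex) wG noise kU Ygamma.
have gamma0 : gamma 0 = z.
  have Y0 : y (k_ j) @[j --> U] --> gamma 0.
    have := Ygamma 0 (lexx _); apply: cvg_trans.
    rewrite (_ : (fun j => y (tick _)) = (fun j => y (k_ j)))//.
    by apply/funext => j; rewrite addr0 tick_clock.
  have Yz : y (k_ j) @[j --> U] --> z.
    pose h_ : nat -> R := fun j => j.+1%:R^-1.
    have hU : h_ @ U --> (0 : R).
      by apply: cvg_trans (@cvg_harmonic R) => A; exact: oU.
    have FU : Filter U by typeclasses eauto.
    apply/(cvgrPdist_le (FF := FU)) => e e0'.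
    have nh : \forall j \near U, `|h_ j| <= e := (cvgr0Pnorm_le (FF := FU) _).1 hU e e0'.
    apply: (@filterS _ U _ _ _ _ nh) => j he.
    rewrite distrC (le_trans _ he)// ltW// (lt_le_trans _ (ler_norm _))//.
    by case: (kP j).
  exact: (@cvg_unique _ (@norm_hausdorff R 'rV[R]_n) (y (k_ j) @[j --> U]) _ _ _ Y0 Yz).
have := lipschitz_descent Dcompact fpot glip gB (gDI UU) T0 (ltW e00) _.
have away t v : 0 <= t <= T -> G (gamma t) v -> e0 <= `|v|.
  move=> /andP[t0 tT]; apply: zr; rewrite -gamma0 (le_lt_trans (glip _ _))//.
  by rewrite subr0 ger0_norm// (le_lt_trans _ LT)// ler_wpM2l.
move=> /(_ away); rewrite gamma0.
have : g z - T * e0 ^+ 2 / 2 <= g (gamma T).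
  rewrite leNgt; apply/negP => gT.
  have d0 : 0 < g z - T * e0 ^+ 2 / 2 - g (gamma T) by rewrite subr_gt0.
  have [r r0' gr] := regularized_continuous flip sigma_gt0 (gamma T) d0.
  have FU : Filter U by typeclasses eauto.
  have nY : \forall j \near U, `|gamma T - y (tick (clock (k_ j) + T))| < r.
    exact: ((cvgrPdist_lt (FF := FU) _ _).1 (Ygamma T (ltW T0))).
  have [j yj] := @filter_ex _ U _ _ nY.
  rewrite distrC in yj; have := gr _ yj.
  have [_ _] := kP j; rewrite ltr_norml => ? /andP[]; lra.
lra.
Qed.


(** [z] is a cluster point of the subsequence of [y] selected by [P]. *)
Definition clusters_along (P : nat -> Prop) (z : 'rV[R]_n) :=
  forall (r : R) (N : nat), 0 < r -> exists k, [/\ (N <= k)%N, P k & `|y k - z| < r].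

Lemma frequent_clusters (P : nat -> Prop) :
  (forall N, exists2 k, (N <= k)%N & P k) -> exists z, clusters_along P z.
Proof.
move=> freq.
have /choice[k_ /all_and2[kN kP]] : forall N, exists k, (N <= k)%N /\ P k.
  by move=> N; have [k ? ?] := freq N; exists k.
have nb : \forall j \near \oo, [set v : 'rV[R]_n | `|v| <= B] ((y \o k_) j).
  by apply: nearW => j; exact: yB.
have [z [_ clz]] := @closed_ball0_compact R n B ((y \o k_) @ \oo) _ nb.
exists z => r N r0.
have tl : ((y \o k_) @ \oo) [set y (k_ j) | j in [set j | (N <= j)%N]].
  by exists N => // j /= Nj; exists j.
have nz : nbhs z [set x : 'rV[R]_n | `|x - z| < r] by apply/nbhs_rVP; exists r.
have [_ [[j /= Nj <-] /= jz]] := clz _ _ tl nz.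
by exists (k_ j); split => //; exact: leq_trans Nj (kN j).
Qed.

Lemma clusters_le P z c : clusters_along P z -> (forall k, P k -> g (y k) <= c) -> g z <= c.
Proof.
move=> Pz cP; rewrite leNgt; apply/negP => zc.
have d0 : 0 < g z - c by rewrite subr_gt0.
have [r r0 gr] := regularized_continuous flip sigma_gt0 z d0.
have [k [_ /cP ck yk]] := Pz r 0%N r0.
have := gr _ yk; rewrite ltr_norml => /andP[]; lra.
Qed.

Lemma small_steps e : 0 < e -> exists N, forall k, (N <= k)%N -> `|y k.+1 - y k| < e.
Proof.
move=> e0.
have L0 : 0 <= L by rewrite (le_trans _ (wL 0)).
have d0 : 0 < e / (L + 1) by rewrite divr_gt0// ltr_wpDl.
have [N _ aN] := (cvgr0Pnorm_lt _).1 a_cvg0 _ d0.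
exists N => k Nk; have := aN k Nk; rewrite ltr_pdivlMr ?ltr_wpDl//.
apply: le_lt_trans; rewrite (le_trans (trajectory_lipschitz a_gt0 ystep wL _ _))//.
by rewrite clockS addrAC subrr add0r mulrC ler_wpM2l// lerDl.
Qed.

Hypothesis sard : ([set g x | x in [set x | G x 0]])° = set0.

Lemma noncritical_value (c1 c2 : R) : c1 < c2 ->
  exists c, c1 < c < c2 /\ forall z, g z = c -> ~ G z 0.
Proof.
move=> c12; apply: contrapT => nc.
have mid : c1 < (c1 + c2) / 2 < c2 by apply/andP; split; lra.
suff : ([set g x | x in [set x | G x 0]])° ((c1 + c2) / 2) by rewrite sard.
have : nbhs ((c1 + c2) / 2) `]c1, c2[%classic.
  by apply: near_in_itvoo; rewrite in_itv.
apply: filterS => c; rewrite /= in_itv /= => c12c.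
apply: contrapT => cG; apply: nc; exists c; split => // z gz Gz.
by apply: cG; exists z.
Qed.

(** Two distinct cluster values would force infinitely many passages of
    [g (y k)] from below a noncritical value [c] to above some [c' > c]. The last
    steps [k] with [g (y k) <= c] before these passages cluster at a point [z]
    with [g z = c]. Since [z] is not stationary, the value is below [c] after a
    short window; but within that window [g (y k)] has neither come back below
    [c] nor had the time to climb to [c']. *)
Lemma cluster_values_le z1 z2 :
  clusters_along xpredT z1 -> clusters_along xpredT z2 -> g z2 <= g z1.
Proof.
move=> az1 az2; rewrite leNgt; apply/negP => z12.
have [c [/andP[z1c cz2] crit]] := noncritical_value z12.
pose c' := (c + g z2) / 2.
have cc' : c < c' by rewrite /c'; lra.
have c'z2 : c' < g z2 by rewrite /c'; lra.
pose P k := [/\ g (y k) <= c, c < g (y k.+1) & exists2 l, (k < l)%N &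
  c' <= g (y l) /\ forall i, (k < i <= l)%N -> c < g (y i)].
have freqP N : exists2 k, (N <= k)%N & P k.
  have d1 : 0 < c - g z1 by rewrite subr_gt0.
  have [r1 r10 gr1] := regularized_continuous flip sigma_gt0 z1 d1.
  have [k0 [Nk0 _ /gr1]] := az1 r1 N r10; rewrite ltr_norml => /andP[_ k0c].
  have d2 : 0 < g z2 - c' by rewrite subr_gt0.
  have [r2 r20 gr2] := regularized_continuous flip sigma_gt0 z2 d2.
  have [l [k0l _ /gr2]] := az2 r2 k0 r20; rewrite ltr_norml => /andP[lc' _].
  have exQ : exists k, (k <= l)%N && (g (y k) <= c) by exists k0; rewrite k0l /=; lra.
  have ubQ k : (k <= l)%N && (g (y k) <= c) -> (k <= l)%N by case/andP.
  have [k /andP[kl kc] kmax] := ex_maxnP exQ ubQ.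
  have k0k : (k0 <= k)%N by apply: kmax; rewrite k0l /=; lra.
  have {}kl : (k < l)%N.
    by rewrite ltn_neqAle kl andbT; apply/eqP => kE; move: kc; rewrite kE; lra.
  have above i : (k < i <= l)%N -> c < g (y i).
    move=> /andP[ki il]; rewrite ltNge; apply/negP => ic.
    by have := kmax i; rewrite il ic => /(_ isT); rewrite leqNgt ki.
  exists k; first exact: leq_trans Nk0 k0k.
  split => //; first by apply: above; rewrite leqnn.
  by exists l => //; split => //; lra.
have [z Pz] := frequent_clusters freqP.
have zc : g z <= c by apply: (clusters_le Pz) => k [].
have cz : c <= g z.
  rewrite leNgt; apply/negP => zc'.
  have d0 : 0 < c - g z by rewrite subr_gt0.
  have [r r0 gr] := regularized_continuous flip sigma_gt0 z d0.
  have r20 : 0 < r / 2 by rewrite divr_gt0.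
  have [N yN] := small_steps r20.
  have [k [Nk [_ ck _] ykz]] := Pz _ N r20.
  have : `|y k.+1 - z| < r.
    rewrite -(subrKA (y k)) (le_lt_trans (ler_normD _ _))// (splitr r) ltrD//.
    exact: yN.
  by move=> /gr; rewrite ltr_norml => /andP[]; lra.
have gzc : g z = c by apply/eqP; rewrite eq_le zc cz.
have [T1 T10 desc] := window_descent (crit z gzc).
have L0 : 0 <= L by rewrite (le_trans _ (wL 0)).
have L1 : 0 < L + 1 by rewrite ltr_wpDl.
have d1 : 0 < c' - g z by rewrite gzc subr_gt0.
have [r1 r10 gr1] := regularized_continuous flip sigma_gt0 z d1.
pose T := Num.min T1 (r1 / 2 / (L + 1)).
have T0 : 0 < T by rewrite lt_min T10 !divr_gt0.
have TT1 : T <= T1 by rewrite ge_min lexx.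
have LT : L * T <= r1 / 2.
  apply: (@le_trans _ _ ((L + 1) * T)); first by rewrite ler_wpM2r ?(ltW T0)// lerDl.
  by rewrite mulrC -ler_pdivlMr// ge_min lexx orbT.
have [|eps eps0 [r r0 [N descN]]] := desc T; first by rewrite T0.
have rr0 : 0 < Num.min r (r1 / 2) by rewrite lt_min r0 divr_gt0.
have [k [Nk [kc _ [l kl [lc' above]]] ykz]] := Pz _ N rr0.
move: ykz; rewrite lt_min => /andP[ykr ykr1].
have := descN k Nk ykr; rewrite gzc => dk.
have ke : (k < tick (clock k + T))%N.
  rewrite ltnNge; apply/negP => /(clock_le a_gt0).
  have := clock_tick_ge a_div (clock k + T); lra.
have [el|le] := leqP (tick (clock k + T)) l.
  by have := above (tick (clock k + T)); rewrite ke el => /(_ isT); lra.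
have : `|y l - z| < r1.
  rewrite -(subrKA (y k)) (le_lt_trans (ler_normD _ _))// (splitr r1) ler_ltD//.
  rewrite (le_trans (trajectory_lipschitz a_gt0 ystep wL _ _))//.
  apply: le_trans LT; rewrite ler_wpM2l//.
  rewrite ger0_norm ?subr_ge0 ?(clock_le a_gt0) ?(ltnW kl)//.
  by rewrite lerBlDl ltW// (clock_lt_tick (a_div := a_div)).
by move=> /gr1; rewrite ltr_norml => /andP[]; lra.
Qed.

(** From a nonstationary cluster point, each visit nearby is followed by a
    decrease of fixed size, which produces a smaller cluster value. *)
Lemma cluster_stationary z : clusters_along xpredT z -> G z 0.
Proof.
move=> az; apply: contrapT => Gz.
have [T1 T10 desc] := window_descent Gz.
have [|eps eps0 [r r0 [N descN]]] := desc T1; first by rewrite T10 lexx.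
have freq M : exists2 e, (M <= e)%N & g (y e) <= g z - eps.
  have [k [Nk _ ykz]] := az r (maxn N M) r0.
  move: Nk; rewrite geq_max => /andP[Nk Mk].
  exists (tick (clock k + T1)); last exact: descN.
  by rewrite (leq_trans Mk)// le_tick// lerDl ltW.
have [z' Pz'] := frequent_clusters freq.
have := clusters_le Pz' (fun k Pk => Pk).
have az' : clusters_along xpredT z'.
  by move=> e M e0; have [k [Mk _ yk]] := Pz' e M e0; exists k.
have := cluster_values_le az' az; lra.
Qed.

End DescentSequence.

(** * Exponential moments of bounded martingale differences *)

Section BorelCantelli.
Context {d} {T : measurableType d} {R : realType} (P : probability T R).

(** Borel-Cantelli, with the summability of [p ^- 2] by telescoping. *)
Lemma ae_eventually_notin (E : nat -> set T) (N0 : nat) :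
  (forall p, measurable (E p)) ->
  (forall p, (N0 < p)%N -> (P (E p) <= ((p%:R : R) ^- 2)%:E)%E) ->
  {ae P, forall w, exists N, forall p, (N <= p)%N -> ~ E p w}.
Proof.
move=> mE PE; pose F j := E (N0 + j.+1)%N.
have PF j : (P (F j) <= (2 * (j.+1%:R^-1 - j.+2%:R^-1))%:E)%E.
  have N0j : (N0 < N0 + j.+1)%N by rewrite addnS ltnS leq_addr.
  rewrite (le_trans (PE _ N0j))// lee_fin.
  have j0 : (0 : R) < j.+1%:R by rewrite ltr0n.
  have j1 : (0 : R) < j.+2%:R by rewrite ltr0n.
  apply: (@le_trans _ _ (j.+1%:R ^- 2)).
    have p0 : (0 : R) < (N0 + j.+1)%:R by rewrite ltr0n addnS.
    rewrite lef_pV2 ?posrE ?exprn_gt0// ler_sqr ?nnegrE ?ler0n// ler_nat.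
    exact: leq_addl.
  have -> : 2 * (j.+1%:R^-1 - j.+2%:R^-1) = 2 / (j.+1%:R * j.+2%:R) :> R.
    rewrite -[j.+2%:R]natr1 in j1 *.
    by move: (j.+1%:R : R) j0 j1 => k k0 k1; field; rewrite !gt_eqF.
  rewrite expr2 ler_pdivlMr ?mulr_gt0// mulrC ler_pdivrMr ?mulr_gt0//.
  rewrite mulrCA ler_pM2l// -natr1.
  have : (1 : R) <= j.+1%:R by rewrite ler1n.
  lra.
have Ffin : (\sum_(j <oo) P (F j) < +oo)%E.
  apply: (@le_lt_trans _ _ 2%:E); last exact: ltry.
  apply: lime_le; first exact: is_cvg_nneseries.
  apply: nearW => N.
  apply: (@le_trans _ _ (\sum_(0 <= j < N) (2 * (j.+1%:R^-1 - j.+2%:R^-1))%:E)%E).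
    by apply: lee_sum => j _; exact: PF.
  rewrite sumEFin lee_fin -mulr_sumr.
  have -> : \sum_(0 <= j < N) (j.+1%:R^-1 - j.+2%:R^-1) = 1 - N.+1%:R^-1 :> R.
    elim: N => [|N IH]; first by rewrite big_geq// invr1 subrr.
    by rewrite big_nat_recr//= IH addrA subrK.
  by rewrite ler_piMr// gerBl.
have mF j : measurable (F j) by exact: mE.
have := lim_sup_set_cvg0 mF Ffin => F0.
exists (lim_sup_set F); split => //.
  apply: bigcap_measurable; first by exists 0%N.
  by move=> k _; apply: bigcup_measurable => j _; exact: mF.
move=> w /= nw j _ /=; apply: contrapT => nF; apply: nw.
exists (N0 + j.+1)%N => p pj Ep; apply: nF.
have N0p : (N0 < p)%N by rewrite (leq_trans _ pj)// addnS ltnS leq_addr.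
exists (p - N0.+1)%N => /=.
  by rewrite -(leq_add2r N0.+1) subnK// addnC addSnnS.
by rewrite /F -addSnnS subnKC.
Qed.

End BorelCantelli.

Section ExponentialMoments.
Context {d} {T : measurableType d} {R : realType} (P : probability T R).

Lemma bounded_integrable (h : T -> R) (C : R) : measurable_fun setT h ->
  (forall w, `|h w| <= C) -> P.-integrable setT (EFin \o h).
Proof.
move=> mh hC; apply: measurable_bounded_integrable => //.
  by rewrite -ge0_fin_numE// fin_num_measure.
exists C; split; first exact: num_real.
by move=> x Cx w _ /=; rewrite (le_trans (hC w))// ltW.
Qed.

Lemma expR_le_quadratic (u : R) : u <= 1 / 2 -> expR u <= 1 + u + 2 * u ^+ 2.
Proof.
move=> u2; have u1 : 0 < 1 - u by lra.
have : expR u <= (1 - u)^-1.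
  rewrite -[u in expR u]opprK expRN lef_pV2 ?posrE ?expR_gt0//.
  by have := expR_ge1Dx (- u).
move=> /le_trans; apply; rewrite -[leLHS]mul1r ler_pdivrMr//.
have : 0 <= u ^+ 2 * (1 - 2 * u) by rewrite mulr_ge0 ?sqr_ge0//; lra.
rewrite expr2; lra.
Qed.

(** The layer-cake approximation of a number by multiples of [e]; it turns a
    bounded function into a combination of indicators of its superlevel sets. *)
Lemma layer_approx (e z : R) (N : nat) : 0 < e -> 0 <= z <= e * N%:R ->
  `|z - \sum_(j < N) e * (e * j.+1%:R <= z)%R%:R| <= e.
Proof.
move=> e0 /andP[z0 zN].
pose s N := \sum_(j < N) e * (e * j.+1%:R <= z)%R%:R.
have s0 : s 0%N = 0 by rewrite /s big_ord0.
have sS k : s k.+1 = s k + e * (e * k.+1%:R <= z)%R%:R.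
  by rewrite /s big_ord_recr.
have claim k : [/\ s k <= z, z <= e * k%:R -> z - s k <= e &
    e * k%:R <= z -> s k = e * k%:R].
  elim: k => [|k [IH1 IH2 IH3]].
    by rewrite s0 mulr0; split => // z0'; lra.
  rewrite sS; case: (leP (e * k.+1%:R) z) => ez /=.
    have ek : e * k%:R <= z by rewrite (le_trans _ ez)// ler_wpM2l ?(ltW e0)// ler_nat.
    have sk : s k + e * 1%:R = e * k.+1%:R by rewrite IH3// -natr1; ring.
    by rewrite sk; split => //; lra.
  rewrite mulr0 addr0; split => // _; have [zk|kz] := leP z (e * k%:R); first exact: IH2.
  by rewrite IH3 ?ltW//; move: ez; rewrite -natr1 mulrDr mulr1; lra.
have [s1 s2 _] := claim N.
by rewrite ger0_norm ?subr_ge0// s2.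
Qed.


(** The coarser sigma-algebra [F] is put on a copy of [T], so that the closure
    properties of measurable functions apply to it. *)
Definition Fmeasurable (F : set_system T) (Z : T -> R) :=
  @measurable_fun _ _ (g_sigma_algebraType F) _ setT Z.

Lemma Fmeasurable_superlevel F Z (r : R) : sigma_algebra setT F ->
  Fmeasurable F Z -> F [set w | r <= Z w].
Proof.
move=> sF mZ; have := mZ measurableT `[r, +oo[%classic (measurable_itv _).
rewrite setTI /measurable /= sigma_algebra_id//.
by congr F; apply/seteqP; split => w /=; rewrite in_itv/= andbT.
Qed.

Lemma Fmeasurable_of_superlevel F Z : (forall r : R, F [set w | r < Z w]) ->
  Fmeasurable F Z.
Proof.
move=> FZ; apply: (measurability _ (RGenOInfty.measurableE R)) => //.
move=> _ [_ [r ->] <-]; rewrite setTI; apply: sub_sigma_algebra.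
rewrite (_ : _ @^-1` _ = [set w | r < Z w]); first exact: FZ.
by apply/seteqP; split => w /=; rewrite in_itv/= andbT.
Qed.

Lemma Fmeasurable_sub F F' Z : F `<=` F' -> Fmeasurable F Z -> Fmeasurable F' Z.
Proof.
move=> FF' mZ _ B mB; have := mZ measurableT B mB.
exact: sub_sigma_algebra2 FF' _.
Qed.

Lemma Fmeasurable_measurable F Z : F `<=` measurable -> Fmeasurable F Z ->
  measurable_fun setT Z.
Proof.
move=> Fm mZ _ B mB; have := mZ measurableT B mB.
by apply: smallest_sub => //; exact: sigma_algebra_measurable.
Qed.

(** Replace [Z] by its layer-cake approximation with step [e = C' / N]: the
    integral of each layer against [X] vanishes because the superlevel sets of
    [Z] are in [F], and the error is at most [e M]. *)
Lemma centered_orthogonal F (X Z : T -> R) (M C : R) :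
  sigma_algebra setT F -> F `<=` measurable ->
  measurable_fun setT X -> (forall w, `|X w| <= M) ->
  (forall A, F A -> (\int[P]_(w in A) (X w)%:E = 0)%E) ->
  Fmeasurable F Z -> (forall w, 0 <= Z w <= C) ->
  (\int[P]_w (Z w * X w) = 0)%R.
Proof.
move=> sF Fm mX XM Xc mZ ZC.
have M0 : 0 <= M by rewrite (le_trans _ (XM point)).
pose C' := Num.max C 1.
have C'0 : 0 < C' by rewrite lt_max ltr01 orbT.
have mZ' := Fmeasurable_measurable Fm mZ.
have ZXint (Y : T -> R) (K : R) : measurable_fun setT Y -> (forall w, `|Y w| <= K) ->
    P.-integrable setT (EFin \o (fun w => Y w * X w)).
  move=> mY YK; apply: (@bounded_integrable _ (K * M)); first exact: measurable_funM.
  by move=> w; rewrite normrM ler_pM.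
suff bound N : `|\int[P]_w (Z w * X w)| * N.+1%:R <= C' * M.
  apply/eqP; have [//|nz] := eqVneq (\int[P]_w (Z w * X w)) 0.
  have v0 : 0 < `|\int[P]_w (Z w * X w)| by rewrite normr_gt0.
  exfalso; set v := `|_| in v0 bound.
  have := bound (Num.bound (C' * M / v)).
  rewrite mulrC -ler_pdivlMr// leNgt => /negP; apply.
  have Cv0 : 0 <= C' * M / v by rewrite divr_ge0 ?(ltW v0)// mulr_ge0// ltW.
  by rewrite (lt_le_trans (archi_boundP Cv0))// ler_nat.
pose e := C' / N.+1%:R.
have e0 : 0 < e by rewrite divr_gt0// ltr0n.
have eN : e * N.+1%:R = C' by rewrite divfK// pnatr_eq0.
pose A j := [set w | e * j.+1%:R <= Z w].
have FA j : F (A j) by exact: Fmeasurable_superlevel.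
have mA j : measurable (A j) by exact: Fm.
pose S k w : R := \sum_(j < k) e * (e * j.+1%:R <= Z w)%R%:R.
have indE j w : (e * j.+1%:R <= Z w)%R%:R = \1_(A j) w :> R.
  by rewrite indicE; congr (nat_of_bool _)%:R; apply/idP/idP => [?|/set_mem//]; apply/mem_set.
have mS k : measurable_fun setT (S k).
  rewrite /S; apply: measurable_sum => j; apply: measurable_funM => //.
  rewrite (_ : (fun w => _) = \1_(A j)); first exact: measurable_indic.
  by apply/funext => w; rewrite indE.
have Sb k w : `|S k w| <= e * k%:R.
  rewrite /S (le_trans (ler_norm_sum _ _ _))// mulr_natr -[k in leRHS]card_ord -sumr_const.
  rewrite ler_sum// => j _; rewrite ger0_norm ?(mulr_ge0 (ltW e0))//.
  by rewrite ler_piMr ?(ltW e0)// lern1 leq_b1.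
have S0 (k : nat) : (\int[P]_w (S k w * X w) = 0 :> R)%R.
  elim: k => [|k IH].
    under eq_Rintegral do rewrite /S big_ord0 mul0r.
    by rewrite Rintegral_cst// mul0r.
  under eq_Rintegral do rewrite /S big_ord_recr/= mulrDl -/(S k _) indE -mulrA.
  have int1 : P.-integrable setT (EFin \o (fun w => \1_(A k) w * X w)).
    apply: (@ZXint _ 1); first exact: measurable_indic.
    by move=> w; rewrite indicE ger0_norm// lern1 leq_b1.
  rewrite RintegralD//; last 2 first.
  - exact: (ZXint _ _ (mS k) (Sb k)).
  - have eint := integrableZl measurableT e int1; exact: eint.
  rewrite IH add0r RintegralZl//.
  have -> : (fun w => \1_(A k) w * X w) = X \_ (A k).
    by apply/funext => w; rewrite patchE indicE; case: ifP; rewrite ?mul1r ?mul0r.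
  by rewrite -Rintegral_mkcond /Rintegral Xc// mulr0.
have intZ : P.-integrable setT (EFin \o (fun w => Z w * X w)).
  apply: (ZXint _ C mZ') => w; have /andP[z0 zC] := ZC w.
  by rewrite ger0_norm.
have intS := ZXint _ _ (mS N.+1) (Sb N.+1).
have -> : \int[P]_w (Z w * X w) = \int[P]_w (Z w * X w - S N.+1 w * X w).
  by rewrite RintegralB// S0 subr0.
have intD : P.-integrable setT (EFin \o (fun w => Z w * X w - S N.+1 w * X w)).
  have iD := integrableB measurableT intZ intS; exact: iD.
rewrite -eN mulrAC ler_pM2r ?ltr0n//.
rewrite (le_trans (le_normr_Rintegral measurableT intD))//.
apply: (@le_trans _ _ (\int[P]_w (cst (e * M) w))).
  apply: le_Rintegral => //.
  - have iN := integrable_norm intD; exact: iN.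
  - exact: (@bounded_integrable (cst (e * M)) `|e * M|).
  - move=> w _ /=; rewrite -mulrBl normrM ler_pM// layer_approx//.
    have /andP[z0 zC] := ZC w; rewrite z0 /= eN (le_trans zC)// le_max lexx //.
by rewrite Rintegral_cst// [fine _](_ : _ = 1) ?mulr1// [X in fine X](@probability_setT _ _ _ P).
Qed.

End ExponentialMoments.

Section MartingaleDifferences.
Context {d} {T : measurableType d} {R : realType} (P : probability T R).
Variables (F : nat -> set_system T) (X : nat -> T -> R) (M : R).
Hypothesis Ffilt : filtration F.
Hypothesis XF : forall k, Fmeasurable (F k) (X k).
Hypothesis XM : forall k w, `|X k w| <= M.
Hypothesis Xc : forall k A, F k A -> (\int[P]_(w in A) (X k.+1 w)%:E = 0)%E.
Variable b : nat -> R.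
Hypothesis b_ge0 : forall k, 0 <= b k.

Definition window_sum p q w := \sum_(p <= i < q) b i * X i.+1 w.

Let sF k : sigma_algebra setT (F k). Proof. by case: Ffilt. Qed.
Let Fm k : F k `<=` measurable. Proof. by case: Ffilt. Qed.

Lemma filtration_le k l : (k <= l)%N -> F k `<=` F l.
Proof.
elim: l => [|l IH]; first by rewrite leqn0 => /eqP ->.
rewrite leq_eqVlt => /orP[/eqP ->//|]; rewrite ltnS => /IH kl.
by apply: subset_trans kl _; case: Ffilt.
Qed.

Lemma window_sum_Fmeasurable p q : (p <= q)%N -> Fmeasurable (F q) (window_sum p q).
Proof.
elim: q => [|q IH].
  rewrite leqn0 => /eqP ->; rewrite /window_sum.
  under [X in Fmeasurable _ X]eq_fun do rewrite big_geq//.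
  exact: measurable_cst.
rewrite leq_eqVlt => /orP[/eqP ->|].
  under [X in Fmeasurable _ X]eq_fun do rewrite /window_sum big_geq//.
  exact: measurable_cst.
rewrite ltnS => pq.
under [X in Fmeasurable _ X]eq_fun do rewrite /window_sum big_nat_recr//=.
apply: measurable_funD.
  by apply: (Fmeasurable_sub _ (IH pq)); apply: filtration_le.
by apply: measurable_funM; [exact: measurable_cst|exact: XF].
Qed.

Lemma window_sum_measurable p q : (p <= q)%N -> measurable_fun setT (window_sum p q).
Proof. by move=> pq; exact: Fmeasurable_measurable (@Fm q) (window_sum_Fmeasurable pq). Qed.

Lemma window_sum_bounded p q w : `|window_sum p q w| <= M * \sum_(p <= i < q) b i.
Proof.
rewrite /window_sum mulr_sumr (le_trans (ler_norm_sum _ _ _))// ler_sum// => i _.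
by rewrite normrM (ger0_norm (b_ge0 _)) mulrC ler_wpM2r.
Qed.

(** Induction on the last index: [expR u <= 1 + u + 2 u^2] for the last
    increment [u], whose linear term integrates to [0] against the preceding
    factor. *)
Lemma window_exp_moment (lam : R) p q : 0 <= lam -> (p <= q)%N ->
  (forall i, (p <= i < q)%N -> lam * b i * M <= 1 / 2) ->
  (\int[P]_w expR (lam * window_sum p q w) <=
    expR (2 * lam ^+ 2 * M ^+ 2 * \sum_(p <= i < q) b i ^+ 2))%R.
Proof.
move=> lam0; have M0 : 0 <= M by rewrite (le_trans _ (XM 0 point)).
have base r : (\int[P]_w expR (lam * window_sum r r w) <=
    expR (2 * lam ^+ 2 * M ^+ 2 * \sum_(r <= i < r) b i ^+ 2))%R.
  under eq_Rintegral do rewrite /window_sum big_geq// mulr0 expR0.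
  rewrite Rintegral_cst// [fine _](_ : _ = 1); last first.
    by rewrite [X in fine X](@probability_setT _ _ _ P).
  by rewrite big_geq// mulr0 expR0 mulr1.
elim: q => [|q IH]; first by rewrite leqn0 => /eqP -> _; exact: base.
rewrite leq_eqVlt => /orP[/eqP -> _|]; first exact: base.
rewrite ltnS => pq small.
have small' i : (p <= i < q)%N -> lam * b i * M <= 1 / 2.
  by move=> /andP[pi iq]; apply: small; rewrite pi leqW.
have {}IH := IH pq small'.
pose Z w := expR (lam * window_sum p q w).
pose K := expR (lam * (M * \sum_(p <= i < q) b i)).
have ZK w : 0 <= Z w <= K.
  rewrite expR_ge0 /= ler_expR ler_wpM2l// (le_trans (ler_norm _))//.
  exact: window_sum_bounded.
have mZF : Fmeasurable (F q) Z.
  apply: measurableT_comp; first exact: measurable_expR.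
  by apply: measurable_funM; [exact: measurable_cst|exact: window_sum_Fmeasurable].
have mZ := Fmeasurable_measurable (@Fm q) mZF.
have mX := Fmeasurable_measurable (@Fm q.+1) (@XF q.+1).
have ZX0 := centered_orthogonal (sF q) (@Fm q) mX (XM q.+1) (@Xc q) mZF ZK.
have Zn w : `|Z w| <= K by have /andP[z0 zK] := ZK w; rewrite ger0_norm.
have intZ := bounded_integrable P mZ Zn.
have intZX : P.-integrable setT (EFin \o (fun w => Z w * X q.+1 w)).
  apply: (@bounded_integrable _ _ _ _ _ (K * M)); first exact: measurable_funM.
  by move=> w; rewrite normrM ler_pM.
pose c := lam * b q * M.
have c0 : 0 <= c by rewrite !mulr_ge0.
have c2 : c <= 1 / 2 by apply: small; rewrite pq leqnn.
have step w : expR (lam * window_sum p q.+1 w) <=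
    (1 + 2 * c ^+ 2) * Z w + lam * b q * (Z w * X q.+1 w).
  rewrite /window_sum big_nat_recr//= -/(window_sum p q w) mulrDr expRD -/(Z w) mulrA.
  have /andP[z0 _] := ZK w.
  set u := lam * b q * X q.+1 w.
  have uc : `|u| <= c by rewrite normrM ger0_norm ?mulr_ge0// ler_wpM2l// mulr_ge0.
  have u2 : u <= 1 / 2 by rewrite (le_trans (ler_norm _))// (le_trans uc).
  have uu : u ^+ 2 <= c ^+ 2 by rewrite -real_normK ?num_real// ler_sqr ?nnegrE.
  apply: (@le_trans _ _ (Z w * (1 + u + 2 * u ^+ 2))).
    by rewrite ler_wpM2l// expR_le_quadratic.
  apply: (@le_trans _ _ (Z w * (1 + u + 2 * c ^+ 2))).
    by rewrite ler_wpM2l// lerD2l ler_wpM2l.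
  by rewrite /u le_eqVlt; apply/orP; left; apply/eqP; ring.
have i1 : P.-integrable setT (EFin \o (fun w => (1 + 2 * c ^+ 2) * Z w)).
  have := integrableZl measurableT (1 + 2 * c ^+ 2) intZ; exact.
have i2 : P.-integrable setT (EFin \o (fun w => lam * b q * (Z w * X q.+1 w))).
  have := integrableZl measurableT (lam * b q) intZX; exact.
have i3 : P.-integrable setT (EFin \o (fun w =>
    (1 + 2 * c ^+ 2) * Z w + lam * b q * (Z w * X q.+1 w))).
  have := integrableD measurableT i1 i2; exact.
have i4 : P.-integrable setT (EFin \o (fun w => expR (lam * window_sum p q.+1 w))).
  apply: (@bounded_integrable _ _ _ _ _ (expR (lam * (M * \sum_(p <= i < q.+1) b i)))).
    apply: measurableT_comp; first exact: measurable_expR.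
    by apply: measurable_funM; [exact: measurable_cst|apply: window_sum_measurable; exact: leqW].
  move=> w; rewrite ger0_norm ?expR_ge0// ler_expR ler_wpM2l//.
  by rewrite (le_trans (ler_norm _))// window_sum_bounded.
rewrite (le_trans (le_Rintegral measurableT i4 i3 (fun w _ => step w)))//.
rewrite RintegralD// RintegralZl// RintegralZl// ZX0 mulr0 addr0.
rewrite big_nat_recr//= mulrDr expRD mulrC ler_pM ?expR_ge0//.
- by apply: Rintegral_ge0 => w _; exact: expR_ge0.
- by rewrite addr_ge0// mulr_ge0// sqr_ge0.
- rewrite (le_trans (expR_ge1Dx _))// ler_expR /c !exprMn.
  by rewrite le_eqVlt; apply/orP; left; apply/eqP; ring.
Qed.

(** Chernoff's bound. *)
Lemma window_sum_tail (lam eps : R) p q : 0 <= lam -> (p <= q)%N ->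
  (forall i, (p <= i < q)%N -> lam * b i * M <= 1 / 2) ->
  (P [set w | (eps <= window_sum p q w)%R] <=
    (expR (2 * lam ^+ 2 * M ^+ 2 * (\sum_(p <= i < q) b i ^+ 2) - lam * eps))%:E)%E.
Proof.
move=> lam0 pq small.
set A := [set w | _].
have mA : measurable A.
  by apply: (Fm (k := q)); apply: Fmeasurable_superlevel (window_sum_Fmeasurable pq).
have i4 : P.-integrable setT (EFin \o (fun w => expR (lam * window_sum p q w))).
  apply: (@bounded_integrable _ _ _ _ _ (expR (lam * (M * \sum_(p <= i < q) b i)))).
    apply: measurableT_comp; first exact: measurable_expR.
    by apply: measurable_funM; [exact: measurable_cst|exact: window_sum_measurable].
  move=> w; rewrite ger0_norm ?expR_ge0// ler_expR ler_wpM2l//.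
  by rewrite (le_trans (ler_norm _))// window_sum_bounded.
have i5 : P.-integrable setT
    (EFin \o (fun w => expR (- (lam * eps)) * expR (lam * window_sum p q w))).
  have := integrableZl measurableT (expR (- (lam * eps))) i4; exact.
have i6 : P.-integrable setT (EFin \o \1_A).
  apply: (@bounded_integrable _ _ _ _ _ 1); first exact: measurable_indic.
  by move=> w; rewrite indicE ger0_norm// lern1 leq_b1.
have PA : P A = (\int[P]_w (\1_A w : R))%:E.
  rewrite /Rintegral integral_indic// setIT fineK//; exact: fin_num_measure.
rewrite PA lee_fin.
apply: (@le_trans _ _ (\int[P]_w (expR (- (lam * eps)) * expR (lam * window_sum p q w)))).
  apply: le_Rintegral => // w _; rewrite indicE -expRD.
  have [/set_mem Aw|_] := boolP (w \in A); last exact: expR_ge0.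
  by rewrite -expR0 ler_expR addrC subr_ge0 ler_wpM2l.
rewrite RintegralZl// addrC expRD ler_wpM2l ?expR_ge0//.
exact: window_exp_moment.
Qed.

End MartingaleDifferences.

(** * The noise vanishes on windows of bounded length *)

Section AlmostSureWindows.
Context {d} {T : measurableType d} {R : realType} (P : probability T R).
Variables (F : nat -> set_system T) (M : R).
Hypothesis Ffilt : filtration F.
Variables (b : nat -> R) (q : nat -> nat) (tau : R).
Hypothesis b_ge0 : forall k, 0 <= b k.
Hypothesis b_log : b k * ln k%:R @[k --> \oo] --> (0 : R).
Hypothesis q_ge : forall p, (p <= q p)%N.
Hypothesis q_tau : forall p, \sum_(p <= i < q p) b i <= tau.

(** With [lam = 4 ln p / eps] the Chernoff bound is [expR] of
    [32 (ln p)^2 M^2 (\sum b i ^+ 2) / eps^2 - 4 ln p]. As [b i ln p <= kap] on the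
    window that starts at [p], the first term is at most
    [32 M^2 kap tau (ln p) / eps^2 <= 2 ln p], and the bound is summable. *)
Lemma window_sum_eventually_lt (X : nat -> T -> R) (eps : R) :
  (forall k, Fmeasurable (F k) (X k)) -> (forall k w, `|X k w| <= M) ->
  (forall k A, F k A -> (\int[P]_(w in A) (X k.+1 w)%:E = 0)%E) -> 0 < eps ->
  {ae P, forall w, exists N, forall p, (N <= p)%N -> window_sum X b p (q p) w < eps}.
Proof.
move=> XF XM Xc eps0.
have M0 : 0 <= M by rewrite (le_trans _ (XM 0%N point)).
have tau0 : 0 <= tau by rewrite (le_trans _ (q_tau 0))// sumr_ge0.
have M1 : 0 < M + 1 by rewrite ltr_wpDl.
have t1 : 0 < tau + 1 by rewrite ltr_wpDl.
(* The first bound makes the increments [lam b i M] at most 1/2, the second one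
   controls the exponent. *)
pose kap := Num.min (eps / (8 * (M + 1))) (eps ^+ 2 / (16 * (M + 1) ^+ 2 * (tau + 1))).
have kap0 : 0 < kap.
  by rewrite lt_min !divr_gt0// ?mulr_gt0// ?exprn_gt0// mulr_gt0.
have kap1 : 4 * kap * M / eps <= 1 / 2.
  have : kap <= eps / (8 * (M + 1)) by rewrite ge_min lexx.
  rewrite ler_pdivlMr ?mulr_gt0// ler_pdivrMr// => h.
  have : 0 <= kap by exact: ltW.
  lra.
have kap2 : 16 * M ^+ 2 * kap * tau <= eps ^+ 2.
  have : kap <= eps ^+ 2 / (16 * (M + 1) ^+ 2 * (tau + 1)) by rewrite ge_min lexx orbT.
  have AB : M ^+ 2 * tau <= (M + 1) ^+ 2 * (tau + 1).
    rewrite ler_pM ?sqr_ge0//; last by rewrite lerDl.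
    by rewrite ler_sqr ?nnegrE ?(ltW M1)// lerDl.
  rewrite ler_pdivlMr ?mulr_gt0 ?exprn_gt0// => h; apply: le_trans h.
  have -> : 16 * M ^+ 2 * kap * tau = kap * (16 * (M ^+ 2 * tau)) by ring.
  have -> : kap * (16 * (M + 1) ^+ 2 * (tau + 1)) =
      kap * (16 * ((M + 1) ^+ 2 * (tau + 1))) by ring.
  by rewrite ler_pM2l// ler_pM2l.
have [N1 _ bN1] := (cvgr0Pnorm_le _).1 b_log _ kap0.
pose E p := [set w | eps <= window_sum X b p (q p) w].
have mE p : measurable (E p).
  have Fm : F (q p) `<=` measurable by case: Ffilt.
  apply: Fm; apply: Fmeasurable_superlevel; first by case: Ffilt.
  exact: window_sum_Fmeasurable.
have PE p : (maxn N1 1 < p)%N -> (P (E p) <= ((p%:R : R) ^- 2)%:E)%E.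
  rewrite gtn_max => /andP[N1p p1].
  have p0 : (0 : R) < p%:R by rewrite ltr0n ltnW.
  have lnp : 0 <= ln p%:R :> R by rewrite ln_ge0// ler1n ltnW.
  pose lam := 4 * ln p%:R / eps.
  have lam0 : 0 <= lam by rewrite divr_ge0 ?(ltW eps0)// mulr_ge0.
  have bln i : (p <= i)%N -> b i * ln p%:R <= kap.
    move=> pi; apply: (@le_trans _ _ (b i * ln i%:R)).
      rewrite ler_wpM2l// ler_ln ?posrE ?ler_nat//.
      by rewrite ltr0n (leq_trans _ pi)// ltnW.
    rewrite (le_trans (ler_norm _))// bN1//=.
    by rewrite (leq_trans (ltnW N1p)).
  have small i : (p <= i < q p)%N -> lam * b i * M <= 1 / 2.
    move=> /andP[pi _]; apply: le_trans kap1.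
    have -> : lam * b i * M = 4 * (b i * ln p%:R) * M / eps.
      by rewrite /lam; field; rewrite gt_eqF.
    by rewrite ler_wpM2r ?invr_ge0 ?(ltW eps0)// ler_wpM2r// ler_pM2l// bln.
  have := window_sum_tail Ffilt XF XM Xc b_ge0 eps lam0 (q_ge p) small.
  move=> /le_trans; apply; rewrite lee_fin.
  have -> : (p%:R : R) ^- 2 = expR (- (2 * ln p%:R)).
    by rewrite expRN expRM_natl lnK// posrE.
  rewrite ler_expR.
  have -> : lam * eps = 4 * ln p%:R by rewrite /lam divfK// gt_eqF.
  suff : 2 * lam ^+ 2 * M ^+ 2 * (\sum_(p <= i < q p) b i ^+ 2) <= 2 * ln p%:R by lra.
  have sb : ln p%:R * \sum_(p <= i < q p) b i ^+ 2 <= kap * tau.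
    apply: (@le_trans _ _ (kap * \sum_(p <= i < q p) b i)); last first.
      by rewrite ler_pM2l.
    rewrite !mulr_sumr big_nat_cond [leRHS]big_nat_cond ler_sum// => i /andP[/andP[pi _] _].
    by rewrite expr2 mulrA ler_wpM2r// mulrC bln.
  set s := \sum_(p <= i < q p) b i ^+ 2 in sb *.
  have -> : 2 * lam ^+ 2 * M ^+ 2 * s =
      2 * ln p%:R * ((16 * M ^+ 2 * (ln p%:R * s)) / eps ^+ 2).
    by rewrite /lam; field; rewrite gt_eqF.
  rewrite ler_piMr ?mulr_ge0// ler_pdivrMr ?exprn_gt0// mul1r (le_trans _ kap2)//.
  rewrite -[leRHS]mulrA ler_wpM2l// ?mulr_ge0// ?sqr_ge0//.
have := ae_eventually_notin mE PE.
apply: (@filterS _ _ (ae_filter_ringOfSetsType P)) => w [N wN].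
by exists N => p Np; rewrite ltNge; apply/negP; exact: wN.
Qed.

Lemma window_sum_cvg0 (X : nat -> T -> R) :
  (forall k, Fmeasurable (F k) (X k)) -> (forall k w, `|X k w| <= M) ->
  (forall k A, F k A -> (\int[P]_(w in A) (X k.+1 w)%:E = 0)%E) ->
  {ae P, forall w, window_sum X b p (q p) w @[p --> \oo] --> (0 : R)}.
Proof.
move=> XF XM Xc.
pose X' k w := - X k w.
have X'F k : Fmeasurable (F k) (X' k) by apply: measurableT_comp => //; exact: XF.
have X'M k w : `|X' k w| <= M by rewrite normrN.
have X'c k A : F k A -> (\int[P]_(w in A) (X' k.+1 w)%:E = 0)%E.
  move=> FA; have mA : measurable A by case: Ffilt => _ Fm _; exact: Fm FA.
  under eq_integral do rewrite EFinN.
  have iX : P.-integrable A (EFin \o X k.+1).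
    apply: (integrableS measurableT) => //; apply: (bounded_integrable P _ (XM k.+1)).
    by apply: Fmeasurable_measurable (@XF k.+1); case: Ffilt.
  rewrite integralN; first by rewrite Xc// oppe0.
  have dX := integrable_add_def mA iX; exact: dX.
have X'E p w : window_sum X' b p (q p) w = - window_sum X b p (q p) w.
  by rewrite /window_sum -sumrN; apply: eq_bigr => i _; rewrite mulrN.
have e0 (l : nat) : (0 : R) < l.+1%:R^-1 by rewrite invr_gt0 ltr0n.
have h1 : {ae P, forall w, forall l : nat, exists N, forall p, (N <= p)%N ->
    window_sum X b p (q p) w < l.+1%:R^-1}.
  by apply: ae_foralln => l; exact: window_sum_eventually_lt (e0 l).
have h2 : {ae P, forall w, forall l : nat, exists N, forall p, (N <= p)%N ->
    window_sum X' b p (q p) w < l.+1%:R^-1}.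
  by apply: ae_foralln => l; exact: window_sum_eventually_lt (e0 l).
move: h1 h2; apply: (@filterS2 _ _ (ae_filter_ringOfSetsType P)) => w w1 w2.
apply/cvgr0Pnorm_le => e e0'.
pose l := Num.bound e^-1.
have le : l.+1%:R^-1 <= e.
  have ei : 0 < e^-1 by rewrite invr_gt0.
  rewrite -[leRHS]invrK lef_pV2 ?posrE ?ltr0n//.
  by rewrite ltW// (lt_le_trans (archi_boundP (ltW ei)))// ler_nat.
have [N1 wN1] := w1 l; have [N2 wN2] := w2 l.
exists (maxn N1 N2) => // p /=; rewrite geq_max => /andP[N1p N2p].
have := wN1 p N1p; have := wN2 p N2p; rewrite X'E => h2 h1.
rewrite ler_norml lerNl (le_trans (ltW h2) le)/=.
exact: le_trans (ltW h1) le.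
Qed.

End AlmostSureWindows.

Section VectorNoise.
Context {d} {T : measurableType d} {R : realType} (P : probability T R) {n : nat}.

Lemma adapted_coord_Fmeasurable (F : set_system T) (Y : T -> 'rV[R]_n) i :
  measurable_wrt F Y -> Fmeasurable F (fun w => Y w 0 i).
Proof.
move=> FY; apply: Fmeasurable_of_superlevel => r.
have -> : [set w | r < Y w 0 i] = Y @^-1` [set v : 'rV[R]_n | r < v 0 i] by [].
apply: FY; apply: sub_sigma_algebra => /=.
have cc : continuous (fun v : 'rV[R]_n => v 0 i) by exact: coord_continuous.
exact: ((continuousP _).1 cc _ (@open_gt R r)).
Qed.

(** Coordinatewise; truncation makes the almost sure bound on the noise hold
    everywhere and changes it on a null set only. *)
Lemma martingale_windows_cvg0 (F : nat -> set_system T) (xi : nat -> T -> 'rV[R]_n)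
    (b : nat -> R) (q : nat -> nat) (tau : R) :
  filtration F -> bounded_martingale_difference P F xi ->
  (forall k, 0 <= b k) -> b k * ln k%:R @[k --> \oo] --> (0 : R) ->
  (forall p, (p <= q p)%N) -> (forall p, \sum_(p <= i < q p) b i <= tau) ->
  {ae P, forall w,
    \sum_(p <= i < q p) b i *: xi i.+1 w @[p --> \oo] --> (0 : 'rV[R]_n)}.
Proof.
move=> Ffilt [xiF [Mxi xiM] xi0] b0 blog qge qtau.
pose M := `|Mxi|.
pose X i k w := Num.max (- M) (Num.min M (xi k w 0 i)).
have M0 : 0 <= M by exact: normr_ge0.
have XF i k : Fmeasurable (F k) (X i k).
  apply: measurable_maxr; first exact: measurable_cst.
  apply: measurable_minr; first exact: measurable_cst.
  exact: adapted_coord_Fmeasurable (xiF k).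
have XM i k w : `|X i k w| <= M.
  rewrite ler_norml /X le_max lexx /= ge_max ge_min lexx andbT.
  by rewrite (le_trans _ M0)// oppr_le0.
have XE i : {ae P, forall w, forall k, X i k w = xi k w 0 i}.
  move: xiM; apply: (@filterS _ _ (ae_filter_ringOfSetsType P)) => w wM k.
  have : `|xi k w 0 i| <= M.
    rewrite (le_trans (normr_coord_le _ _))// (le_trans (normr_le_enorm _))//.
    by rewrite (le_trans (wM k))// ler_norm.
  rewrite ler_norml => /andP[lo hi].
  by rewrite /X min_r// max_r.
have Xc i k A : F k A -> (\int[P]_(w in A) (X i k.+1 w)%:E = 0)%E.
  move=> FA; have [_ Fm _] := Ffilt; have mA : measurable A := Fm _ _ FA.
  have [_ /(_ i)[xint _ /(_ A FA) xiA]] := xi0 k.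
  transitivity (\int[P]_(w in A) (xi k.+1 w 0 i)%:E)%E.
    apply: ae_eq_integral => //.
    - apply/measurable_EFinP; apply: measurable_funTS.
      exact: Fmeasurable_measurable (Fm k.+1) (XF i k.+1).
    - by apply: measurable_funTS; exact: measurable_int xint.
    - move: (XE i); apply: (@filterS _ _ (ae_filter_ringOfSetsType P)) => w wE _.
      by rewrite wE.
  rewrite -xiA /= integral0_eq//.
  by move=> w _; rewrite mxE.
have h : {ae P, forall w, forall i : 'I_n,
    window_sum (X i) b p (q p) w @[p --> \oo] --> (0 : R)}.
  apply: (@filter_forall _ _ _ _ (ae_filter_ringOfSetsType P)) => i.
  apply: (window_sum_cvg0 Ffilt b0 blog qge qtau (M := M)).
  - exact: XF.
  - exact: XM.
  - exact: Xc.
have XEall := @filter_forall _ _ _ _ (ae_filter_ringOfSetsType P) XE.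
move: h XEall; apply: (@filterS2 _ _ (ae_filter_ringOfSetsType P)) => w wh wX.
apply/cvgr0Pnorm_le => e e0.
have : \forall p \near \oo, forall i : 'I_n, `|window_sum (X i) b p (q p) w| <= e.
  by apply: filter_forall => i; exact: (cvgr0Pnorm_le _).1 (wh i) e e0.
apply: filterS => p pe; apply: normr_rV_le; first exact: ltW.
move=> i; rewrite summxE.
rewrite (_ : \sum_(_ <= _ < _) _ = window_sum (X i) b p (q p) w)//.
by apply: eq_bigr => k _; rewrite !mxE wX.
Qed.

End VectorNoise.

(** * A single path of the iteration *)

Lemma cvg_seq_bounded_above {R : realType} (u : nat -> R) (l : R) :
  u @ \oo --> l -> exists C, forall k, u k <= C.
Proof.
move=> ul; have [N _ uN] : \forall k \near \oo, u k <= l + 1.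
  by apply: (cvgr_le _ ul); rewrite ltrDl.
exists (`|l + 1| + \sum_(i < N) `|u i|) => k.
have s0 : 0 <= \sum_(i < N) `|u i| by exact: sumr_ge0.
have [Nk|kN] := leqP N k.
  by rewrite (le_trans (uN k Nk))// (le_trans (ler_norm _))// lerDl.
rewrite (le_trans (ler_norm _))// (bigD1 (Ordinal kN))//= addrCA lerDl.
by rewrite addr_ge0// sumr_ge0.
Qed.

Lemma contraction_cvg0 {R : realType} (e b : nat -> R) (r : R) :
  0 <= r < 1 -> (forall k, 0 <= e k) -> (forall k, e k.+1 <= r * (e k + b k)) ->
  b @ \oo --> (0 : R) -> e @ \oo --> (0 : R).
Proof.
move=> /andP[r0 r1] e0 eS bcvg; apply/cvgr0Pnorm_le => eps eps0.
have d0 : 0 < eps / 2 * (1 - r) by rewrite mulr_gt0 ?divr_gt0 ?subr_gt0.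
have [N _ bN] := (cvgr0Pnorm_le _).1 bcvg _ d0.
have step j : e (N + j)%N <= r ^+ j * e N + eps / 2.
  elim: j => [|j IH]; first by rewrite addn0 expr0 mul1r lerDl divr_ge0 ?ltW.
  rewrite addnS (le_trans (eS _))// exprS.
  have bj : b (N + j)%N <= eps / 2 * (1 - r).
    by rewrite (le_trans (ler_norm _))// bN//= leq_addr.
  rewrite mulrDr.
  have h1 := ler_wpM2l r0 IH.
  have h2 := ler_wpM2l r0 bj.
  have h3 : r * (eps / 2 * (1 - r)) <= 1 * (eps / 2 * (1 - r)).
    by rewrite ler_pM2r// ltW.
  rewrite -mulrA; lra.
have rcvg : (fun j => r ^+ j * e N) @ \oo --> (0 : R).
  rewrite -(mul0r (e N)); apply: cvgM; last exact: cvg_cst.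
  by apply: cvg_expr; rewrite ger0_norm.
have e20 : 0 < eps / 2 by rewrite divr_gt0.
have [J _ rJ] := (cvgr0Pnorm_le _).1 rcvg _ e20.
exists (N + J)%N => // k /= NJk.
have Nk : (N <= k)%N by rewrite (leq_trans _ NJk)// leq_addr.
rewrite ger0_norm// -(subnKC Nk) (le_trans (step _))// (splitr eps) lerD//.
  by rewrite (le_trans (ler_norm _))// rJ//= leq_subRL.
by rewrite -splitr.
Qed.

Lemma averaging_bounded {R : realType} {n : nat} (theta : nat -> R)
    (m u : nat -> 'rV[R]_n) (C : R) :
  (forall k, 0 <= theta k) -> theta @ \oo --> (0 : R) ->
  (forall k, m k.+1 = (1 - theta k) *: m k + theta k *: u k) ->
  (forall k, `|u k| <= C) -> exists B, forall k, `|m k| <= B.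
Proof.
move=> th0 thcvg mS uC.
have [K _ thK] : \forall k \near \oo, theta k <= 1 by exact: (cvgr_le _ thcvg _ ltr01).
pose B := `|C| + \sum_(i < K.+1) `|m i|.
have s0 N : 0 <= \sum_(i < N) `|m i| by exact: sumr_ge0.
have small k : (k <= K)%N -> `|m k| <= B.
  rewrite -ltnS => kK; rewrite /B (bigD1 (Ordinal kK))//= addrCA lerDl.
  by rewrite addr_ge0// sumr_ge0.
exists B => k; have [/small//|] := leqP k K.
elim: k => // k IH; rewrite ltnS => Kk.
have mk : `|m k| <= B.
  by move: Kk; rewrite leq_eqVlt => /orP[/eqP <-|/IH//]; exact: small.
rewrite mS (le_trans (ler_normD _ _))// !normrZ.
have t1 : theta k <= 1 by exact: thK.
rewrite ger0_norm ?subr_ge0// ger0_norm//.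
have uB : `|u k| <= B by rewrite (le_trans (uC k))// (le_trans (ler_norm _))// lerDl.
have h1 : (1 - theta k) * `|m k| <= (1 - theta k) * B by rewrite ler_wpM2l// subr_ge0.
have h2 : theta k * `|u k| <= theta k * B by rewrite ler_wpM2l.
lra.
Qed.

Lemma dist_lt_ex {R : realType} {n : nat} (v : 'rV[R]_n) (A : set 'rV[R]_n) (c : R) :
  A !=set0 -> dist v A < c -> exists2 a, A a & `|v - a| < c.
Proof.
move=> [a0 Aa0] vc.
have hi : has_inf [set enorm (v - a) | a in A].
  split; first by exists (enorm (v - a0)); exists a0.
  by exists 0 => _ [a _ <-]; rewrite sqrtr_ge0.
have e0 : 0 < c - dist v A by rewrite subr_gt0.
have [_ [a Aa <-]] := inf_adherent e0 hi.
move=> vac; have {}vac : enorm (v - a) < c by move: vac; rewrite -/(dist v A); lra.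
by exists a => //; exact: le_lt_trans (normr_le_enorm _) vac.
Qed.

Section IterationPath.
Context {R : realType} {n : nat}.
Variables (sigma : R) (f : 'rV[R]_n -> R) (D : 'rV[R]_n -> set 'rV[R]_n).
Hypothesis sigma_gt0 : 0 < sigma.
Hypothesis flip : locally_lipschitz f.
Hypothesis Dclosed : closed [set p : 'rV[R]_n * 'rV[R]_n | D p.1 p.2].
Hypothesis Dneq0 : forall x, D x !=set0.
Hypothesis Dcompact : forall x, compact (D x).
Hypothesis Dconvex : forall x, @convex_set R 'rV[R]_n (D x).
Hypothesis fpot : potential f D.
Local Notation G := (regularized_field sigma D).
Local Notation g := (regularized sigma f).
Hypothesis sard : ([set g x | x in [set x | G x 0]])° = set0.

Variables (H : 'rV[R]_n -> 'rV[R]_n) (eta theta delta : nat -> R).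
Variables (eps_v M_v eta0 eta1 Mx Mxi : R).
Variables (x m v gr d xi : nat -> 'rV[R]_n).
Hypothesis eps_v_gt0 : 0 < eps_v.
Hypothesis H_bounds : forall k i, eps_v <= H (v k) 0 i <= M_v.
Hypothesis x_bounded : forall k, `|x k| <= Mx.
Hypothesis xi_bounded : forall k, `|xi k| <= Mxi.
Hypothesis theta_gt0 : forall k, 0 < theta k.
Hypothesis theta_cvg0 : theta @ \oo --> (0 : R).
Hypothesis eta0_gt0 : 0 < eta0.
Hypothesis eta1_lt : eta1 * (sigma * M_v) < 2.
Hypothesis eta_bounds : forall k, eta0 <= eta k <= eta1.
Hypothesis delta_ge0 : forall k, 0 <= delta k.
Hypothesis delta_cvg0 : delta @ \oo --> (0 : R).
Hypothesis d_enlargement : forall k, enlargement D (delta k) (x k) (d k).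
Hypothesis framework : AFMDW H sigma eta theta x m v gr d xi.

(* The momentum, rescaled to the point towards which it drives the iterates, is
   a stochastic subgradient sequence for [g] with step sizes [a]. *)
Let a k := theta k / sigma.
Let y k := - (sigma^-1 *: m k).

Hypothesis a_div : forall c : R, exists n, c <= \sum_(i < n) a i.
Hypothesis noise : forall j : nat,
  \sum_(k <= i < tick a_div (clock a k + j.+1%:R^-1)) a i *: xi i.+1 @[k --> \oo]
    --> (0 : 'rV[R]_n).

Let a_gt0 k : 0 < a k. Proof. by rewrite divr_gt0. Qed.

Let a_cvg0 : a @ \oo --> (0 : R).
Proof. by rewrite -(mul0r sigma^-1); apply: cvgM => //; exact: cvg_cst. Qed.

Let d_bounded : exists C, forall k, `|d k| <= C.
Proof.
have [Delta dD] := cvg_seq_bounded_above delta_cvg0.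
have [C DC] := field_bounded flip Dclosed Dneq0 Dcompact Dconvex fpot (Mx + Delta).
exists (C + Delta + 1) => k.
have [z zx dz] := d_enlargement k.
have zM : `|z| <= Mx + Delta.
  rewrite -(subrK (x k) z) addrC (le_trans (ler_normD _ _))// lerD//.
  by rewrite (le_trans (normr_le_enorm _))// (le_trans zx).
have dlt : dist (d k) (D z) < Delta + 1.
  by rewrite (le_lt_trans dz)// (le_lt_trans (dD k))// ltrDl.
have [b Db db] := dist_lt_ex (Dneq0 z) dlt.
rewrite -(subrK b (d k)) addrC -addrA (le_trans (ler_normD _ _))//.
by rewrite lerD ?(ltW db)//; exact: DC Db.
Qed.

Let gr_bounded : exists C, forall k, `|gr k| <= C.
Proof.
have [C dC] := d_bounded; exists (C + Mxi) => k.
by have [-> _ _] := framework k; rewrite (le_trans (ler_normD _ _))// lerD.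
Qed.

Let y_bounded : exists B, forall k, `|y k| <= B.
Proof.
have [C grC] := gr_bounded.
have mS k : m k.+1 = (1 - theta k) *: m k + theta k *: gr k by case: (framework k).
have [B mB] := averaging_bounded (fun k => ltW (theta_gt0 k)) theta_cvg0 mS grC.
exists (sigma^-1 * B) => k.
by rewrite normrN normrZ gtr0_norm ?invr_gt0// ler_pM2l ?invr_gt0.
Qed.

Let w k := d k + sigma *: y k.

Let y_step k : y k.+1 = y k - a k *: (w k + xi k.+1).
Proof.
have [grE mE _] := framework k; rewrite /y mE grE /w /a /y.
apply/rowP => i; rewrite !mxE; field; rewrite gt_eqF//.
Qed.

Let w_bounded : exists L, forall k, `|w k + xi k.+1| <= L.
Proof.
have [C dC] := d_bounded; have [B yB] := y_bounded.
exists (C + sigma * B + Mxi) => k.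
rewrite (le_trans (ler_normD _ _))// lerD// (le_trans (ler_normD _ _))// lerD//.
by rewrite normrZ gtr0_norm// ler_pM2l.
Qed.

(** For frozen momentum the iteration contracts towards [y k.+1] in every
    coordinate, with factor [1 - eta k * sigma * H_i] of modulus at most [r < 1],
    and the momentum moves by [O (theta k)] only. *)
Lemma iterates_track_momentum : `|x k - y k| @[k --> \oo] --> (0 : R).
Proof.
have [L wL] := w_bounded.
have L0 : 0 <= L by rewrite (le_trans _ (wL 0%N)).
pose r := Num.max 0 (Num.max (1 - eta0 * (sigma * eps_v)) (eta1 * (sigma * M_v) - 1)).
have r01 : 0 <= r < 1.
  rewrite le_max lexx /= !gt_max ltr01 /=; apply/andP; split; last by move: eta1_lt; lra.
  by rewrite gtrBl !mulr_gt0.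
have contr k : `|x k.+1 - y k.+1| <= r * `|x k - y k.+1|.
  have [_ _ xE] := framework k.
  have r0 : 0 <= r by case/andP: r01.
  apply: normr_rV_le; first by rewrite mulr_ge0.
  move=> i.
  have -> : (x k.+1 - y k.+1) 0 i =
      (1 - eta k * (sigma * H (v k.+1) 0 i)) * (x k - y k.+1) 0 i.
    by rewrite xE /y !mxE; field; rewrite gt_eqF.
  rewrite normrM ler_pM ?normr_coord_le//.
  have /andP[e0 e1] := eta_bounds k; have /andP[h0 h1] := H_bounds k.+1 i.
  have Mv1 : 0 < M_v by rewrite (lt_le_trans eps_v_gt0)// (le_trans h0).
  have lo : eta0 * (sigma * eps_v) <= eta k * (sigma * H (v k.+1) 0 i).
    rewrite ler_pM ?(ltW eta0_gt0) ?mulr_ge0 ?(ltW sigma_gt0) ?(ltW eps_v_gt0)//.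
    by rewrite ler_pM2l.
  have hi : eta k * (sigma * H (v k.+1) 0 i) <= eta1 * (sigma * M_v).
    rewrite ler_pM ?(le_trans (ltW eta0_gt0) e0)//.
      by rewrite mulr_ge0 ?(ltW sigma_gt0)// (le_trans (ltW eps_v_gt0)).
    by rewrite ler_pM2l.
  rewrite ler_norml /r !le_max; apply/andP; split; last first.
    by apply/orP; right; apply/orP; left; lra.
  rewrite lerNl !le_max; apply/orP; right; apply/orP; right; lra.
apply: (contraction_cvg0 (b := fun k => L * a k) r01) => //.
- move=> k; rewrite (le_trans (contr k))// ler_wpM2l//; first by case/andP: r01.
  have -> : x k - y k.+1 = (x k - y k) + (y k - y k.+1) by rewrite addrA subrK.
  rewrite (le_trans (ler_normD _ _))// lerD2l.
  rewrite y_step opprB addrC subrK normrZ gtr0_norm// mulrC.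
  by rewrite ler_wpM2r// ltW.
- by rewrite -(mulr0 L); apply: cvgM => //; exact: cvg_cst.
Qed.

(* The evaluation points of [d k] are asymptotically close to [x k], hence to
   [y k]; the rest is upper semicontinuity. *)
Let w_tracks (z : 'rV[R]_n) (e : R) : 0 < e -> exists2 r : R, 0 < r &
  exists N : nat, forall k, (N <= k)%N -> `|y k - z| < r ->
    exists2 u, G z u & `|w k - u| < e.
Proof.
move=> e0; have e40 : 0 < e / 4 by rewrite divr_gt0.
have [r r0 zr] := field_usc flip Dclosed Dneq0 Dcompact Dconvex fpot z e40.
have r30 : 0 < r / 3 by rewrite divr_gt0.
have es0 : 0 < e / 4 / sigma by rewrite divr_gt0.
exists (Num.min (r / 3) (e / 4 / sigma)); first by rewrite lt_min r30.
have m0 : 0 < Num.min (r / 3) (e / 4) by rewrite lt_min r30.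
have [N1 _ dN] := (cvgr0Pnorm_lt _).1 delta_cvg0 _ m0.
have [N2 _ xN] := (cvgr0Pnorm_lt _).1 iterates_track_momentum _ r30.
exists (maxn N1 N2) => k; rewrite geq_max => /andP[N1k N2k].
rewrite lt_min => /andP[yr ye].
have := dN k N1k; rewrite ger0_norm// lt_min => /andP[dr de].
have := xN k N2k; rewrite normr_id => xy.
have [u ux du] := d_enlargement k.
have uz : `|u - z| < r.
  have -> : u - z = (u - x k) + (x k - y k) + (y k - z) by rewrite !subrKA.
  have h1 := ler_normD ((u - x k) + (x k - y k)) (y k - z).
  have h2 := ler_normD (u - x k) (x k - y k).
  have h3 := normr_le_enorm (u - x k).
  lra.
have dlt : dist (d k) (D u) < e / 2 by lra.
have [b Db db] := dist_lt_ex (Dneq0 u) dlt.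
have [c Dc bc] := zr u uz b Db.
exists (c + sigma *: z); first by exists c.
have -> : w k - (c + sigma *: z) = (d k - b) + (b - c) + sigma *: (y k - z).
  by rewrite /w; apply/rowP => i; rewrite !mxE; ring.
have h1 := ler_normD ((d k - b) + (b - c)) (sigma *: (y k - z)).
have h2 := ler_normD (d k - b) (b - c).
have h3 : `|sigma *: (y k - z)| < e / 4.
  by rewrite normrZ gtr0_norm// mulrC -ltr_pdivlMr.
lra.
Qed.

Lemma path_convergence :
  (forall z, cluster (x k @[k --> \oo]) z -> stationary G z) /\
  cvg (g (x k) @[k --> \oo]).
Proof.
have [L wL] := w_bounded; have [B yB] := y_bounded.
have xy := iterates_track_momentum.
have stat := cluster_stationary flip Dclosed Dneq0 Dcompact Dconvex fpot
  sigma_gt0 a_gt0 a_cvg0 y_step yB wL w_tracks noise sard.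
have same := cluster_values_le flip Dclosed Dneq0 Dcompact Dconvex fpot
  sigma_gt0 a_gt0 a_cvg0 y_step yB wL w_tracks noise sard.
split=> [z clz|].
  suff : clusters_along y xpredT z.
    by move=> /stat Gz; apply: sub_smallest Gz.
  move=> r N r0; have r20 : 0 < r / 2 by rewrite divr_gt0.
  have [N1 _ xN] := (cvgr0Pnorm_lt _).1 xy _ r20.
  have tl : (x @ \oo) [set x k | k in [set k | (maxn N N1 <= k)%N]].
    by exists (maxn N N1) => // k /= Nk; exists k.
  have nz : nbhs z [set u : 'rV[R]_n | `|u - z| < r / 2].
    by apply/nbhs_rVP; exists (r / 2).
  have [_ [[k /= + <-] /= kz]] := clz _ _ tl nz.
  rewrite geq_max => /andP[Nk N1k]; exists k; split => //.
  have := xN k N1k; rewrite normr_id => xk.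
  have -> : y k - z = - (x k - y k) + (x k - z) by rewrite opprB addrA subrK.
  by rewrite (le_lt_trans (ler_normD _ _))// normrN (splitr r) ltrD.
have [z0 az0] : exists z, clusters_along y xpredT z.
  by apply: (frequent_clusters yB) => N; exists N.
apply/cvg_ex; exists (g z0); apply/cvgrPdist_le => e e0 /=.
apply: contrapT => nfar.
have freq N : exists2 k, (N <= k)%N & e < `|g z0 - g (x k)|.
  apply: contrapT => nk; apply: nfar; exists N => // k /= Nk.
  by rewrite leNgt; apply/negP => ek; apply: nk; exists k.
have [z Pz] := frequent_clusters yB freq.
have az : clusters_along y xpredT z.
  by move=> r N r0; have [k [Nk _ yk]] := Pz r N r0; exists k.
have gz : g z = g z0 by apply/eqP; rewrite eq_le !same.
have [r r0 gz_near] := regularized_continuous flip sigma_gt0 z e0.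
have r20 : 0 < r / 2 by rewrite divr_gt0.
have [N1 _ xN] := (cvgr0Pnorm_lt _).1 xy _ r20.
have [k [Nk ek yk]] := Pz _ N1 r20.
have : `|x k - z| < r.
  rewrite -(subrKA (y k)) (le_lt_trans (ler_normD _ _))// (splitr r) ltrD//.
  by have := xN k Nk; rewrite normr_id.
by move=> /gz_near; rewrite gz distrC ltNge (ltW ek).
Qed.

End IterationPath.


(** * Almost sure convergence *)

Theorem theorem3p8 (R : realType) (n : nat)
  (disp : measure_display) (Omega : measurableType disp)
  (P : probability Omega R) (F : nat -> set_system Omega)
  (sigma : R) (f : 'rV[R]_n -> R) (Df : 'rV[R]_n -> set 'rV[R]_n)
  (H : 'rV[R]_n -> 'rV[R]_n) (eta theta : nat -> R) (eps_v M_v : R)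
  (x m v gr d xi : nat -> Omega -> 'rV[R]_n)
  (g := regularized sigma f) (Dg := regularized_field sigma Df)
  (sigma_gt0 : 0 < sigma)
  (f_lip : locally_lipschitz f)
  (A1 : [/\ path_differentiable f, conservative_field Df, potential f Df &
            forall y, @convex_set R 'rV[R]_n (Df y)])
  (A2 : ([set g y | y in [set y | Dg y 0]])° = set0)
  (A3 : (-oo < ereal_inf (range (fun y => (g y)%:E)))%E)
  (F_filtration : filtration F)
  (random_vectors : forall k,
     [/\ random_vector (x k), random_vector (m k) & random_vector (v k)] /\
     [/\ random_vector (gr k), random_vector (d k) & random_vector (xi k)])
  (framework : forall w, AFMDW H sigma eta theta
     (x ^~ w) (m ^~ w) (v ^~ w) (gr ^~ w) (d ^~ w) (xi ^~ w))
  (B1 : [/\ 0 < eps_v, eps_v < M_v &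
            forall w k (i : 'I_n), eps_v <= H (v k w) 0 i <= M_v])
  (B2 : exists M_x : R,
     {ae P, forall w, enorm (m 0%N w) <= M_x /\
                      forall k, enorm (x k w) <= M_x})
  (B3_pos : forall k, 0 < eta k /\ 0 < theta k)
  (B3_eta_inf : (0 < ereal_inf (range (fun k => (eta k)%:E)))%E)
  (B3_eta_sup :
     (ereal_sup (range (fun k => (eta k)%:E)) < (2 / (sigma * M_v))%:E)%E)
  (B3_theta_sum : (\sum_(0 <= k <oo) (theta k)%:E = +oo)%E)
  (B3_theta_log : theta k * ln k%:R @[k --> \oo] --> 0)
  (B4 : exists delta : nat -> R,
     [/\ forall k, 0 <= delta k, delta k @[k --> \oo] --> 0 &
         forall w k, enlargement Df (delta k) (x k w) (d k w)])
  (B5 : bounded_martingale_difference P F xi) :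
  {ae P, forall w,
     (forall z, cluster (x k w @[k --> \oo]) z -> stationary Dg z) /\
     cvg (g (x k w) @[k --> \oo])}.
Proof.
have [_ [Dclosed Dneq0 Dcompact _] fpot Dconvex] := A1.
have [eps_v0 epsM H_bounds] := B1.
have M_v0 : 0 < M_v by exact: lt_trans epsM.
have [delta [delta0 deltacvg d_enl]] := B4.
have [Mx boundx] := B2.
have [_ [Mxi boundxi] _] := B5.
have theta0 k : 0 < theta k by case: (B3_pos k).
have inf_le k : (ereal_inf (range (fun k => (eta k)%:E)) <= (eta k)%:E)%E.
  by apply: ereal_inf_lbound; exists k.
have le_sup k : ((eta k)%:E <= ereal_sup (range (fun k => (eta k)%:E)))%E.
  by apply: ereal_sup_ubound; exists k.
have [eta0 eta0E] : exists r : R, ereal_inf (range (fun k => (eta k)%:E)) = r%:E.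
  move: B3_eta_inf (inf_le 0%N); case: ereal_inf => [r| |]//= _ _; by exists r.
have [eta1 eta1E] : exists r : R, ereal_sup (range (fun k => (eta k)%:E)) = r%:E.
  move: B3_eta_sup (le_sup 0%N); case: ereal_sup => [r| |]//= _ _; by exists r.
have eta0_gt0 : 0 < eta0 by move: B3_eta_inf; rewrite eta0E lte_fin.
have eta1_lt : eta1 * (sigma * M_v) < 2.
  by move: B3_eta_sup; rewrite eta1E lte_fin ltr_pdivlMr// mulr_gt0.
have eta_bounds k : eta0 <= eta k <= eta1.
  by have := inf_le k; have := le_sup k; rewrite eta0E eta1E !lee_fin => -> ->.
have theta_cvg0 : theta @ \oo --> (0 : R).
  have ln2 : 0 < ln 2 :> R by rewrite ln_gt0// ltr1n.
  apply/cvgr0Pnorm_le => e e0.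
  have [N _ thN] := (cvgr0Pnorm_le _).1 B3_theta_log _ (mulr_gt0 e0 ln2).
  exists (maxn N 2) => // k /=; rewrite geq_max => /andP[Nk k2].
  have lnk : ln 2 <= ln k%:R :> R.
    by rewrite ler_ln ?posrE ?ltr0n ?(ltnW k2)// ler_nat.
  rewrite -(ler_pM2r ln2) (le_trans _ (thN k Nk))//= normrM.
  by rewrite ler_wpM2l// (le_trans lnk)// ler_norm.
pose a k := theta k / sigma.
have a_gt0 k : 0 < a k by rewrite divr_gt0.
have a_cvg0 : a @ \oo --> (0 : R).
  by rewrite -(mul0r sigma^-1); apply: cvgM => //; exact: cvg_cst.
have a_log : a k * ln k%:R @[k --> \oo] --> (0 : R).
  have -> : (fun k => a k * ln k%:R) = (fun k => theta k * ln k%:R * sigma^-1).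
    by apply/funext => k; rewrite /a mulrAC.
  by rewrite -(mul0r sigma^-1); apply: cvgM => //; exact: cvg_cst.
have a_div (c : R) : exists N, c <= \sum_(i < N) a i.
  apply: contrapT => nN.
  suff : (\sum_(0 <= k <oo) (theta k)%:E <= (c * sigma)%:E)%E.
    by rewrite B3_theta_sum leye_eq.
  apply: lime_le.
    by apply: is_cvg_nneseries => k _ _; rewrite lee_fin ltW.
  apply: nearW => N; rewrite sumEFin lee_fin.
  have : \sum_(i < N) a i <= c.
    by rewrite leNgt; apply/negP => /ltW cN; apply: nN; exists N.
  by rewrite /a -mulr_suml ler_pdivrMr// big_mkord.
have [A aA] := cvg_seq_bounded_above a_cvg0.
have A0 : 0 <= A by rewrite (le_trans (ltW (a_gt0 0%N))).
(* A window of length [1 / (j + 1)] overshoots by at most one step. *)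
have noise (j : nat) : {ae P, forall w,
    \sum_(p <= i < tick a_div (clock a p + j.+1%:R^-1)) a i *: xi i.+1 w
      @[p --> \oo] --> (0 : 'rV[R]_n)}.
  have h0 : (0 : R) <= j.+1%:R^-1 by rewrite invr_ge0.
  have pq p : (p <= tick a_div (clock a p + j.+1%:R^-1))%N.
    by apply: (le_tick a_gt0); rewrite lerDl.
  apply: (martingale_windows_cvg0 F_filtration B5 (fun k => ltW (a_gt0 k)) a_log pq
    (tau := j.+1%:R^-1 + A)) => p.
  rewrite -clock_windowE// lerBlDl addrA.
  have pp : clock a p <= clock a p + j.+1%:R^-1 by rewrite lerDl.
  have := clock_tick_le a_gt0 a_div A0 (fun i _ => aA i) pp; exact.
have {}noise := ae_foralln noise.
move: boundx boundxi noise; apply: (@filterS3 _ _ (ae_filter_ringOfSetsType P)) => w.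
move=> [_ xM] xiM wnoise.
apply: (@path_convergence R n sigma f Df sigma_gt0 f_lip Dclosed Dneq0 Dcompact Dconvex fpot
  A2 H eta theta delta eps_v M_v eta0 eta1 Mx Mxi (x ^~ w) (m ^~ w) (v ^~ w) (gr ^~ w)
  (d ^~ w) (xi ^~ w)) => //.
- by move=> k; rewrite (le_trans (normr_le_enorm _)).
- by move=> k; rewrite (le_trans (normr_le_enorm _)).
Qed.
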